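(* Let $1\le q\le+\infty$ and $1\le p<+\infty$. Let $\{u_k\}_{k\in\mathbb{N}}$ be a bounded sequence in $L^q(\Omega;\mathbb{R}^m)$ and $\{w_k\}_{k\in\mathbb{N}}$ a bounded sequence in $L^p(\Omega;\mathbb{R}^{m\times n})$. Then there is a (non-relabeled) subsequence $\{(u_k,w_k)\}$, a DiPerna-Majda measure $(\sigma,\hat\nu)\in\mathcal{DM}^p_{\mathcal{R}}(\Omega;\mathbb{R}^{m\times n})$ and $\hat\mu\in\mathcal{Y}(\bar\Omega\times\beta_{\mathcal{R}}\mathbb{R}^{m\times n};\beta_{\mathcal{U}}\mathbb{R}^m)$ such that for every $f_0\in\mathcal{U}$, every $\psi_0\in\mathcal{R}$ and every $g\in C(\bar\Omega)$, $$\lim_{k\to\infty}\int_\Omega g(x)f_0(u_k(x))\psi(w_k(x))\,dx=\int_{\bar\Omega}\int_{\beta_{\mathcal{R}}\mathbb{R}^{m\times n}}\int_{\beta_{\mathcal{U}}\mathbb{R}^m}g(x)f_0(r)\psi_0(s)\,\hat\mu_{s,x}(dr)\,\hat\nu_x(ds)\,\sigma(dx),$$ where $\psi(s):=\psi_0(s)(1+|s|^p)$. Moreover, the measure $(\sigma,\hat\nu)$ is generated by $\{w_k\}$.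
   Context: $\Omega\subset\mathbb{R}^n$ is a bounded domain with Lipschitz boundary, $m,n\ge1$. A complete ring of bounded continuous real functions on a Euclidean space $E$ is a ring of bounded continuous functions $E\to\mathbb{R}$ that contains the constants, separates points from closed subsets, and is closed in the supremum norm. A separable complete ring corresponds to a metrizable compactification of $E$ (a compact metrizable space into which $E$ is embedded homeomorphically and densely; $E$ is identified with its image) such that the elements of the ring are exactly the functions having a (unique) continuous extension to the compactification; the extension is denoted by the same symbol. $\mathcal{U}$ is a separable complete ring on $\mathbb{R}^m$ with compactification $\beta_{\mathcal{U}}\mathbb{R}^m$, and $\mathcal{R}$ is a separable complete ring on $\mathbb{R}^{m\times n}$ with compactification $\beta_{\mathcal{R}}\mathbb{R}^{m\times n}$. $\mathcal{M}(S)$ denotes the (finite, signed) Radon measures on $S$. For a positive $\sigma\in\mathcal{M}(\bar\Omega)$, a Young measure $\hat\nu=\{\hat\nu_x\}_{x\in\bar\Omega}$ on $(\bar\Omega,\sigma)$ is a family of probability measures on $\beta_{\mathcal{R}}\mathbb{R}^{m\times n}$, defined for $\sigma$-a.e. $x$, which is weakly* $\sigma$-measurable: $x\mapsto\int\psi_0\,d\hat\nu_x$ is $\sigma$-measurable for every continuous $\psi_0$ on $\beta_{\mathcal{R}}\mathbb{R}^{m\times n}$. A sequence $\{w_k\}\subset L^p(\Omega;\mathbb{R}^{m\times n})$ generates $(\sigma,\hat\nu)$ if for all $g\in C(\bar\Omega)$ and $\psi_0\in\mathcal{R}$, with $\psi(s)=\psi_0(s)(1+|s|^p)$, $$\lim_{k\to\infty}\int_\Omega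 g(x)\psi(w_k(x))\,dx=\int_{\bar\Omega}g(x)\int_{\beta_{\mathcal{R}}\mathbb{R}^{m\times n}}\psi_0(s)\,\hat\nu_x(ds)\,\sigma(dx).$$ $\mathcal{DM}^p_{\mathcal{R}}(\Omega;\mathbb{R}^{m\times n})$ (the DiPerna-Majda measures) is the set of all pairs $(\sigma,\hat\nu)$ generated by some sequence in $L^p(\Omega;\mathbb{R}^{m\times n})$. $\hat\mu\in\mathcal{Y}(\bar\Omega\times\beta_{\mathcal{R}}\mathbb{R}^{m\times n};\beta_{\mathcal{U}}\mathbb{R}^m)$ means that $\hat\mu=\{\hat\mu_{s,x}\}$ is a family of probability measures on $\beta_{\mathcal{U}}\mathbb{R}^m$, parametrized by $(x,s)\in\bar\Omega\times\beta_{\mathcal{R}}\mathbb{R}^{m\times n}$, defined for a.e. $(x,s)$ with respect to the measure $\hat\nu_x(ds)\sigma(dx)$ and weakly* measurable, i.e. $(x,s)\mapsto\int f_0\,d\hat\mu_{s,x}$ is measurable for every $f_0\in C(\beta_{\mathcal{U}}\mathbb{R}^m)$. *)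

(* Defs.v *)
From HB Require Import structures.
From mathcomp Require Import all_boot all_order all_algebra.
From mathcomp Require Import all_classical all_reals all_analysis.

Set Implicit Arguments.
Unset Strict Implicit.
Unset Printing Implicit Defensive.
Import Order.TTheory GRing.Theory Num.Theory.
Import numFieldNormedType.Exports.

Local Open Scope classical_set_scope.
Local Open Scope ring_scope.

Notation borel E := (g_sigma_algebraType (open : set (set E))).

Section lebesgue.
Context {R : realType}.

Section step.
Variable n : nat.

Definition rV_cons (z : measurableTypeR R * borel 'rV[R]_n) :
    borel 'rV[R]_n.+1 :=
  row_mx (z.1%:M : 'M[R]_1) z.2.

Definition rV_uncons (v : borel 'rV[R]_n.+1) :
    measurableTypeR R * borel 'rV[R]_n :=
  (v 0 0, \row_j v 0 (lift ord0 j)).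

Lemma rV_consK : cancel rV_cons rV_uncons.
Proof.
move=> [x v]; rewrite /rV_cons /rV_uncons /=; congr pair.
  by rewrite mxE; case: splitP => // j _; rewrite ord1 mxE eqxx mulr1n.
apply/rowP => j; rewrite !mxE; case: splitP => k /=; first by rewrite ord1.
by rewrite /bump /= add1n => -[] kj; congr (v 0 _); apply: val_inj.
Qed.

Lemma rV_unconsK : cancel rV_uncons rV_cons.
Proof.
move=> v; rewrite /rV_cons /rV_uncons /=; apply/rowP => j; rewrite !mxE.
case: splitP => k /= jk; rewrite !mxE.
  rewrite ord1 eqxx mulr1n; congr (v 0 _); apply: val_inj.
  by rewrite /= jk ord1.
by congr (v 0 _); apply: val_inj; rewrite /= jk.
Qed.

Lemma measurable_rV_cons : measurable_fun [set: _] rV_cons.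
Proof.
apply: (@measurability _ _ (measurableTypeR R * borel (matrix R 1 n))%type (borel (matrix R 1 n.+1)) _ _ (open : set (set (matrix R 1 n.+1)))) => //.
move=> _ [V oV <-]; rewrite setTI.
pose B (ck : 'rV[rat]_n.+1 * nat) : set 'rV[R]_n.+1 :=
  ball (map_mx ratr ck.1 : 'rV[R]_n.+1) (ck.2.+1%:R^-1).
pose F ck : set (measurableTypeR R * borel 'rV[R]_n) :=
  [set z | B ck `<=` V /\ B ck (rV_cons z)].
have -> : rV_cons @^-1` V = \bigcup_ck F ck.
  apply/seteqP; split=> [z Vz|z [ck _ [BV]]]; last exact: BV.
  move: oV; rewrite openE => /(_ _ Vz).
  rewrite /interior -nbhs_ballE => -[e /= e0 eV].
  have [k ke] : exists k : nat, k.+1%:R^-1 < e / 2.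
    have /ltr_add_invr[k] : 0 < e / 2 by rewrite divr_gt0.
    by rewrite add0r; exists k.
  have k0 : 0 < k.+1%:R^-1 :> R by rewrite invr_gt0.
  have dq (x : R) : exists q : rat, ball (ratr q : R) k.+1%:R^-1 x.
    have [|y [xy [q _ qy]]] := @dense_rat R (ball x k.+1%:R^-1) _ (ball_open x _).
      by exists x; exact: ballxx.
    by exists q; rewrite qy; exact: ball_sym.
  pose c : 'rV[rat]_n.+1 := \row_j sval (cid (dq (rV_cons z 0 j))).
  have Bz : B (c, k) (rV_cons z).
    split=> // i j; rewrite ord1 /c /= [X in ball X]mxE [X in ratr X]mxE; exact: (svalP (cid (dq (rV_cons z 0 j)))).
  exists (c, k) => //; split=> // v Bv; apply: eV.
  apply: (@le_ball _ _ _ (k.+1%:R^-1 + k.+1%:R^-1)).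
    by rewrite (splitr e) lerD// ltW.
  exact: ball_triangle (ball_sym Bz) Bv.
apply: countable_bigcupT_measurable; first exact: countableP.
move=> [c k]; have [BV|nBV] := pselect (B (c, k) `<=` V); last first.
  by rewrite (_ : F _ = set0)//; apply/seteqP; split=> // z [].
have k0 : 0 < k.+1%:R^-1 :> R by rewrite invr_gt0.
rewrite (_ : F _ = ball (ratr (c 0 0) : R) k.+1%:R^-1 `*`
   (ball (\row_j ratr (c 0 (lift ord0 j)) : 'rV[R]_n) k.+1%:R^-1)); last first.
  apply/seteqP; split=> z.
    case=> _ [_ Bz]; split => /=.
      by have := Bz 0 0; rewrite !mxE; case: splitP => // j _; rewrite ord1 !mxE eqxx mulr1n.
    split => // i j; have := Bz 0 (lift ord0 j); rewrite !mxE ord1.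
    case: splitP => l /=; first by rewrite ord1.
    by rewrite /bump /= add1n => -[] kj; congr (ball _ _ (z.2 0 _)); apply: val_inj.
  case=> /= z1 [_ z2]; split=> //; split=> // i j; rewrite !mxE.
  case: splitP => l /= jl.
    rewrite !mxE !ord1 eqxx mulr1n.
    by rewrite (_ : j = 0)//; apply: val_inj; rewrite /= jl ord1.
  rewrite (_ : j = lift ord0 l); last by apply: val_inj; rewrite /= jl.
  by have := z2 0 l; rewrite mxE !ord1.
apply: measurableX.
  by apply: (@measurable_realfun.open_measurable R); exact: ball_open.
by apply: sub_sigma_algebra; exact: ball_open.
Qed.

Lemma continuous_rV_tail : continuous
  (fun v : 'rV[R]_n.+1 => \row_j v 0 (lift ord0 j) : 'rV[R]_n).
Proof.
move=> v; apply/(@cvg_ballP R _ _ _ (nbhs_filter v)) => e e0.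
apply/nbhs_ballP; exists e => //= w [_ vw].
by split=> // i j; rewrite !mxE.
Qed.

Lemma measurable_rV_uncons : measurable_fun [set: _] rV_uncons.
Proof.
apply/measurable_fun_pair.
- apply: (@measurability _ _ (borel (matrix R 1 n.+1)) (measurableTypeR R) _ _
    (@measurable_realfun.RGenOpens.G R)); first exact: measurable_realfun.RGenOpens.measurableE.
  move=> _ [_ [a [b ->]] <-]; rewrite setTI; apply: sub_sigma_algebra.
  have /continuousP := @coord_continuous R 1 n.+1 0 0; apply.
  exact: interval_open.
- apply: (@measurability _ _ (borel (matrix R 1 n.+1)) (borel (matrix R 1 n)) _ _
    (open : set (set (matrix R 1 n)))) => //.
  move=> _ [V oV <-]; rewrite setTI; apply: sub_sigma_algebra.
  move: V oV; apply/continuousP/continuous_rV_tail.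
Qed.

Section measure.
Variable mu : {sigma_finite_measure set (borel 'rV[R]_n) -> \bar R}.

Definition lebesgue_step : set (borel 'rV[R]_n.+1) -> \bar R :=
  pushforward (lebesgue_measure \x mu)%E rV_cons.

Let lebesgue_step0 : lebesgue_step set0 = 0%E.
Proof. by rewrite /lebesgue_step /pushforward preimage_set0 measure0. Qed.

Let lebesgue_step_ge0 A : (0 <= lebesgue_step A)%E.
Proof. by apply: integral_ge0 => x _; exact: measure_ge0. Qed.

Let lebesgue_step_sigma_additive : semi_sigma_additive lebesgue_step.
Proof.
have mpre A : measurable A -> measurable (rV_cons @^-1` A).
  by move=> mA; rewrite -[X in measurable X]setTI; exact: measurable_rV_cons.
move=> F mF tF mUF; rewrite /lebesgue_step /pushforward preimage_bigcup.
apply: measure_semi_sigma_additive => [k||].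
- by apply: mpre; exact: mF.
- apply/trivIsetP => i j _ _ ij; rewrite -preimage_setI.
  by move/trivIsetP : tF => /(_ _ _ I I ij) ->; rewrite preimage_set0.
- by rewrite -preimage_bigcup; exact: mpre.
Qed.

HB.instance Definition _ := isMeasure.Build _ _ _ lebesgue_step
  lebesgue_step0 lebesgue_step_ge0 lebesgue_step_sigma_additive.

Let lebesgue_step_sigma_finite : sigma_finite setT lebesgue_step.
Proof.
pose leb : {sigma_finite_measure set (measurableTypeR R) -> \bar R} :=
  lebesgue_measure.
have /sigma_finiteP[F [FT ndF Foo]] := sigma_finiteT leb.
have /sigma_finiteP[G [GT ndG Goo]] := sigma_finiteT mu.
have FGT : \bigcup_k (F k `*` G k) = setT.
  apply/seteqP; split=> // -[x y] _.
  have : (\bigcup_i F i) x by rewrite -FT.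
  have : (\bigcup_i G i) y by rewrite -GT.
  move=> [j _ Gy] [i _ Fx]; exists (maxn i j) => //; split => /=.
    by move: Fx; apply/subsetPset/ndF/leq_maxl.
  by move: Gy; apply/subsetPset/ndG/leq_maxr.
exists (fun k => rV_uncons @^-1` (F k `*` G k)).
  by rewrite -preimage_bigcup FGT.
move=> k; have [mF Fk] := Foo k; have [mG Gk] := Goo k; split.
  rewrite -[X in measurable X]setTI; apply: measurable_rV_uncons => //.
  exact: measurableX.
rewrite /lebesgue_step /pushforward -comp_preimage.
rewrite (_ : _ \o _ = id) ?preimage_id; last exact/funext/rV_consK.
by rewrite product_measure1E// lte_mul_pinfty// ge0_fin_numE.
Qed.

HB.instance Definition _ := Measure_isSigmaFinite.Build _ _ _ lebesgue_step
  lebesgue_step_sigma_finite.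

End measure.
End step.

(* Lebesgue measure on the Borel sets of R^n, as the n-fold product of the
   Lebesgue measure of the line; [lebesgue_rV_box] characterizes it. *)
Fixpoint lebesgue_rV n :
    {sigma_finite_measure set (borel 'rV[R]_n) -> \bar R} :=
  if n is k.+1 then lebesgue_step (lebesgue_rV k)
  else dirac (0 : borel 'rV[R]_0).

Lemma lebesgue_rV_box n (a b : 'rV[R]_n) : (forall j, a 0 j <= b 0 j) ->
  lebesgue_rV n [set v | forall j, a 0 j <= v 0 j <= b 0 j] =
    (\prod_(j < n) (b 0 j - a 0 j))%:E.
Proof.
pose box n (a b : 'rV[R]_n) : set (borel 'rV[R]_n) :=
  [set v | forall j, a 0 j <= v 0 j <= b 0 j].
suff : (forall j, a 0 j <= b 0 j) -> measurable (box n a b) /\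
    lebesgue_rV n (box n a b) = (\prod_(j < n) (b 0 j - a 0 j))%:E.
  by move=> h /h[].
elim: n => [|n IH] in a b * => ab.
  rewrite (_ : box 0%N a b = setT); last by apply/seteqP; split=> // v _ [].
  by split=> //=; rewrite big_ord0 diracT.
pose tl (v : 'rV[R]_n.+1) : 'rV[R]_n := \row_j v 0 (lift ord0 j).
have [|mB BE] := IH (tl a) (tl b); first by move=> j; rewrite !mxE.
have boxE : box n.+1 a b =
    @rV_uncons n @^-1` (`[a 0 0, b 0 0]%classic `*` box n (tl a) (tl b)).
  apply/seteqP; split=> v.
    move=> vab; split=> /=; first by rewrite in_itv /= vab.
    by move=> j; rewrite !mxE vab.
  case=> /=; rewrite in_itv /= => v0 vab j.
  case: (unliftP ord0 j) => [k ->|->//]; have := vab k.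
  by rewrite !mxE.
have mI : measurable (`[a 0 0, b 0 0]%classic : set (measurableTypeR R)).
  exact: measurable_itv.
split.
  rewrite boxE -[X in measurable X]setTI; apply: measurable_rV_uncons => //.
  exact: measurableX.
transitivity ((lebesgue_measure \x lebesgue_rV n)%E
    (`[a 0 0, b 0 0]%classic `*` box n (tl a) (tl b))).
  rewrite boxE /= /lebesgue_step /pushforward -comp_preimage.
  by rewrite (_ : _ \o _ = id) ?preimage_id//; exact/funext/rV_consK.
rewrite product_measure1E// BE big_ord_recl EFinM; congr (_ * _)%E.
  apply: etrans (lebesgue_measure_itv _) _; rewrite /= lte_fin.
  by case: ltgtP (ab 0) => // ->; rewrite subrr.
by congr EFin; apply: eq_bigr => j _; rewrite !mxE.
Qed.

End lebesgue.

Section domain.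
Context {R : realType} {n : nat}.
Implicit Types Om : set 'rV[R]_n.

(* After the orthogonal change of coordinates y = x *m Q, the set Om is locally
   the strict epigraph, in the i-th coordinate, of a Lipschitz function of the
   n - 1 other coordinates. *)
Definition lipschitz_boundary Om :=
  forall x0, (closure Om `\` interior Om) x0 ->
  exists (Q : 'M[R]_n) (i : 'I_n) (gamma : 'rV[R]_n.-1 -> R^o),
    [/\ Q *m Q^T = 1%:M,
        lipschitz gamma &
        \forall x \near x0,
          Om x <-> gamma (col' i (x *m Q)) < (x *m Q) 0 i].

Definition bounded_lipschitz_domain Om :=
  [/\ Om !=set0, open Om, connected Om, bounded_set Om & lipschitz_boundary Om].

End domain.

Section compactification.
Context {R : realType}.

Definition separates_points_from_closed (E : topologicalType)
    (A : set (E -> R)) :=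
  forall (F : set E) (x : E), closed F -> ~ F x ->
  exists2 f, A f & ~ closure (f @` F) (f x).

Definition complete_ring (E : topologicalType) (A : set (E -> R)) :=
  [/\ forall f, A f -> continuous f /\ exists M, forall x, `|f x| <= M,
      [/\ forall c, A (cst c),
          forall f g, A f -> A g -> A (f \- g) &
          forall f g, A f -> A g -> A (f \* g)],
      separates_points_from_closed A &
      forall f, (forall e, 0 < e -> exists2 g, A g &
                   forall x, `|f x - g x| <= e) -> A f].

Definition sup_separable (E : Type) (A : set (E -> R)) :=
  exists D : set (E -> R), [/\ countable D, D `<=` A &
    forall f e, A f -> 0 < e -> exists2 g, D g &
      forall x, `|f x - g x| <= e].

Definition metrizable (K : topologicalType) :=
  exists d : K -> K -> R,
  [/\ forall x y, d x y = 0 <-> x = y,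
      forall x y, d x y = d y x,
      forall x y z, d x z <= d x y + d y z &
      forall x (N : set K),
        nbhs x N <-> exists2 e, 0 < e & [set y | d x y < e] `<=` N].

Definition topological_embedding (E K : topologicalType) (i : E -> K) :=
  injective i /\
  forall V : set E, open V <-> exists2 W : set K, open W & V = i @^-1` W.

(* [i : E -> K] is the metrizable compactification of [E] whose continuous
   functions restrict exactly to the elements of [A]. *)
Definition compactification_of (E K : topologicalType) (A : set (E -> R))
    (i : E -> K) :=
  [/\ compact [set: K], metrizable K, topological_embedding i,
      dense (range i) &
      forall f : E -> R,
        A f <-> exists2 F : K -> R, continuous F & F \o i = f].

(* The continuous extension of [f] along [i]: it exists when [f] belongs to the
   ring of the compactification, and it is unique because [range i] is dense. *)
Definition extension (E K : topologicalType) (i : E -> K) (f : E -> R) :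
    K -> R :=
  get [set F : K -> R | continuous F /\ F \o i = f].

End compactification.

Section integrability.
Context {R : realType} {n : nat}.
Implicit Type Om : set 'rV[R]_n.

(* The norm of the library on matrices is the maximum norm. *)
Definition enorm a b (s : 'M[R]_(a, b)) : R :=
  Num.sqrt (\sum_(i < a) \sum_(j < b) s i j ^+ 2).

Definition Lp_norm Om (q : \bar R) a b (u : 'rV[R]_n -> 'M[R]_(a, b)) : \bar R :=
  ('N[lebesgue_rV n]_q [((fun x : borel 'rV[R]_n => (enorm (u x))%:E) \_ Om)])%E.

(* Elements of L^q(Om) are given by Borel representatives, total functions on
   R^n whose values outside Om play no role. *)
Definition in_Lp Om (q : \bar R) a b (u : 'rV[R]_n -> 'M[R]_(a, b)) :=
  measurable_fun (Om : set (borel 'rV[R]_n))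
    (u : borel 'rV[R]_n -> borel 'M[R]_(a, b)) /\
  (Lp_norm Om q u < +oo)%E.

Definition bounded_in_Lp Om (q : \bar R) a b
    (u : nat -> 'rV[R]_n -> 'M[R]_(a, b)) :=
  (forall k, in_Lp Om q (u k)) /\
  exists C : R, forall k, (Lp_norm Om q (u k) <= C%:E)%E.

End integrability.

(* Measurability on D with respect to the mu-completion of the sigma-algebra. *)
Definition ae_measurable_fun d (T : measurableType d) (R : realType)
    (mu : set T -> \bar R) (D : set T) (f : T -> R) :=
  exists2 h : T -> R, measurable_fun D h &
    {ae mu, forall x, D x -> f x = h x}.

Section young_measures.
Context {R : realType} {n : nat}.
Implicit Type Om : set 'rV[R]_n.

(* Families of probability measures are total; they only matter almost
   everywhere. *)
Definition young_measure (K : ptopologicalType) Om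
    (sigma : set (borel 'rV[R]_n) -> \bar R)
    (nu : 'rV[R]_n -> probability (borel K) R) :=
  forall F : K -> R, continuous F ->
  ae_measurable_fun sigma (closure Om : set (borel 'rV[R]_n))
    (fun x => \int[nu x]_s F s).

(* The measure nu_x(ds) sigma(dx) on closure Om * K. *)
Definition disintegrated_measure (K : ptopologicalType) Om
    (sigma : set (borel 'rV[R]_n) -> \bar R)
    (nu : 'rV[R]_n -> probability (borel K) R)
    (B : set (borel 'rV[R]_n * borel K)) : \bar R :=
  (\int[sigma]_(x in (closure Om : set (borel 'rV[R]_n))) nu x (xsection B x))%E.

Definition parametrized_young_measure (K L : ptopologicalType) Om
    (sigma : set (borel 'rV[R]_n) -> \bar R)
    (nu : 'rV[R]_n -> probability (borel K) R)
    (mu : 'rV[R]_n -> K -> probability (borel L) R) :=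
  forall F : L -> R, continuous F ->
  ae_measurable_fun (disintegrated_measure Om sigma nu)
    ((closure Om : set (borel 'rV[R]_n)) `*` [set: borel K])
    (fun xs => \int[mu xs.1 xs.2]_r F r).

Section DiPerna_Majda.
Context {a b : nat} {K : ptopologicalType}.
Variables (Om : set 'rV[R]_n) (p : R) (A : set ('M[R]_(a, b) -> R)).
Variable i : 'M[R]_(a, b) -> K.

Definition growth (psi0 : 'M[R]_(a, b) -> R) (s : 'M[R]_(a, b)) : R :=
  psi0 s * (1 + enorm s `^ p).

Definition generates (w : nat -> 'rV[R]_n -> 'M[R]_(a, b))
    (sigma : {finite_measure set (borel 'rV[R]_n) -> \bar R})
    (nu : 'rV[R]_n -> probability (borel K) R) :=
  forall (g : 'rV[R]_n -> R) (psi0 : 'M[R]_(a, b) -> R),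
  {within closure Om, continuous g} -> A psi0 ->
  \int[lebesgue_rV n]_(x in Om) (g x * growth psi0 (w k x)) @[k --> \oo] -->
  \int[sigma]_(x in closure Om) (g x * \int[nu x]_s extension i psi0 s).

(* A measure on closure Om is represented by its extension by zero to R^n; as
   closure Om is compact, every finite Borel measure on it is a Radon measure. *)
Definition DiPerna_Majda :
    set ({finite_measure set (borel 'rV[R]_n) -> \bar R} *
         ('rV[R]_n -> probability (borel K) R)) :=
  fun '(sigma, nu) =>
  [/\ sigma (~` closure Om) = 0%E, young_measure Om sigma nu &
      exists2 w, (forall k, in_Lp Om p%:E (w k)) & generates w sigma nu].

End DiPerna_Majda.
End young_measures.

(* Main.v *)
Require Import Defs.
From HB Require Import structures.
From mathcomp Require Import ring lra finmap all_boot all_order all_algebra.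
From mathcomp Require Import all_classical all_reals all_analysis.
From mathcomp Require Import measurable_realfun.

Set Implicit Arguments.
Unset Strict Implicit.
Unset Printing Implicit Defensive.
Import Order.TTheory GRing.Theory Num.Theory.
Import numFieldNormedType.Exports.

Local Open Scope classical_set_scope.
Local Open Scope ring_scope.

(** Write [y_k = iV \o w_k] and [r_k = iU \o u_k].  The integrals in the statement
are integrals of continuous functions [(x, s, r) |-> g x * G s * F r] on the
compact metrizable space closure Om x KV x KU against the image of the measure
(1 + |w_k|^p) dx under [x |-> (x, y_k x, r_k x)]; here [F] and [G] are the
continuous extensions of [f0] and [psi0].  The total masses of these image
measures stay bounded, because Om is bounded and [w_k] is bounded in L^p
([Rintegral_growth_le]).  So a subsequence converges weakly to a finite measure
[Lam] ([joint_limit]).  Let [sigma] be the marginal of [Lam] on closure Om.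
Two successive disintegrations of [Lam], first over its marginal on
closure Om x KV and then of that marginal over [sigma], yield [mu] and [nu]
([iterated_disintegration]), which is the limit formula.  Taking [f0 = 1], whose
extension is 1 by density, says that [w_k] generates [(sigma, nu)].

Both the weak limit and the conditional probabilities are built from the same
combinatorial object.  A countable family of small balls codes every point of a
compact metrizable space by a 0-1 sequence, in such a way that a long initial
word of the code determines the point up to a small error ([mesh]).  A measure
then amounts to the masses of the cells of points that share a word, and these
form a nonnegative additive weight on the binary tree ([tree_mass]).
Conversely, every such weight whose positive cells are inhabited is realized by
a measure, as far as continuous functions can see: subdivide an interval of length the total weight according to the
weights of the words, so that every point of the interval acquires a code, and
decode by compactness; under the image of Lebesgue measure, continuous functions
have integrals close to their sums over cells with the given weights
([tree_law]).  Integrals of continuous functions are approximated by sums over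
cells with an error which only involves the oscillation of the function
([sample_sum]).  Hence

- weak limits arise from convergence of countably many cell masses, obtained by
  diagonal extraction ([weak_limit]);
- conditional probabilities arise from the Radon-Nikodym densities of countably
  many cell masses; off a null set these densities form a weight on the tree
  ([conditional_weights]).  The disintegration identity extends from continuous
  functions to Borel sets through indicators of open sets and a pi-lambda
  argument ([disintegration_sets]), and then to bounded measurable functions of
  both variables ([disintegration]). *)

(** * Binary codes of the points of a compact set *)

Section coding.
Context {R : realType}.

Definition word (c : nat -> bool) (J : nat) : seq bool := mkseq c J.

Definition bits (E : Type) (b : nat -> set E) (y : E) : nat -> bool :=
  fun j => `[< b j y >].

Lemma wordP (c c' : nat -> bool) J :
  word c J = word c' J <-> forall j, (j < J)%N -> c j = c' j.
Proof.
split=> [cc' j jJ|cc'].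
  by have := congr1 (nth false ^~ j) cc'; rewrite !nth_mkseq.
by apply/eq_in_map => j; rewrite mem_iota => /andP[_]; exact: cc'.
Qed.

Lemma word_le (c c' : nat -> bool) J J' : (J <= J')%N ->
  word c J' = word c' J' -> word c J = word c' J.
Proof.
by move=> JJ' /wordP cc'; apply/wordP => j jJ; apply: cc'; exact: leq_trans JJ'.
Qed.

(** The codes by membership in the [b j] separate points, uniformly near each
point: when [y] is close to [x], every point sharing a long enough word with [y]
is close to [x].  Being stated by a neighbourhood filter, the condition passes to
products and feeds directly into covering compactness. *)
Definition mesh (E : topologicalType) (S : set E) (b : nat -> set E) :=
  forall x, S x -> forall N, nbhs x N ->
  \forall y \near x & J \near \oo,
    S y -> forall z, S z -> word (bits b y) J = word (bits b z) J -> N z.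

Definition osc_le (E : Type) (S : set E) (b : nat -> set E) (F : E -> R) (J : nat) (e : R) :=
  forall y z, S y -> S z -> word (bits b y) J = word (bits b z) J ->
  `|F y - F z| <= e.

Definition realized (E : Type) (S : set E) (b : nat -> set E)
    (c : nat -> bool) :=
  forall J, exists2 y, S y & word (bits b y) J = word c J.

(** The code of a point obtained as a limit need not be the code that was
prescribed, since membership in an open set is unstable under limits.  What
survives is the metric information: [x] lies within the oscillation of [F] over
the cell of any word of [c].  That is all that integrals of continuous functions
see. *)
Definition decodes (E : topologicalType) (S : set E) (b : nat -> set E)
    (x : E) (c : nat -> bool) :=
  [/\ S x, realized S b c &
    forall (F : E -> R) J (e : R), {within S, continuous F} -> osc_le S b F J e ->
      forall y, S y -> word (bits b y) J = word c J -> `|F x - F y| <= e].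

Section mesh.
Context (E : topologicalType) (S : set E) (b : nat -> set E).

Lemma decodes_bits x : S x -> decodes S b x (bits b x).
Proof.
move=> Sx; split=> //; first by move=> J; exists x.
by move=> F J e _ o y Sy yx; exact: o.
Qed.

(** Uniform continuity in terms of codes: locally the length [J] exists by [mesh]
and continuity, and near-covering compactness makes it global. *)
Lemma mesh_osc_le (F : E -> R) (e : R) : compact S -> mesh S b ->
  {within S, continuous F} -> 0 < e -> exists J, osc_le S b F J e.
Proof.
move=> /compact_near_coveringP cS mS /subspace_continuousP cF e0.
have /(_ nat \oo (fun J y => S y -> forall z, S z ->
  word (bits b y) J = word (bits b z) J -> `|F y - F z| <= e)) := cS.
case=> [x Sx|J _ /(_ J (leqnn _)) h].
  have := cF _ Sx; move=> /cvgrPdist_lt /(_ (e / 2)); rewrite divr_gt0//.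
  move=> /(_ isT); rewrite near_withinE => nF.
  have [[N M] /= [xN [J _ JM]] NM] := mS _ Sx _ nF.
  apply: (filter_app2 _ _ (filter_prod1 nF) (filter_prod2 (nbhs_infty_ge J))).
  exists (N, M); first by split => //=; exists J.
  move=> [y K] /= [Ny MK] Fy JK Sy z Sz yz.
  have Fz := NM (y, K) (conj Ny MK) Sy z Sz yz.
  rewrite (splitr e) -(subrKA (F x)).
  apply: le_trans (ler_normD _ _) _; apply: lerD; last exact/ltW/Fz.
  by rewrite distrC; exact/ltW/Fy.
by exists J => y z Sy; exact: h.
Qed.

(** Any cluster point of points realizing longer and longer words of [c] works. *)
Lemma exists_decoding c : compact S -> realized S b c -> exists x, decodes S b x c.
Proof.
move=> cS rc; have /choice[y yP] : forall J, exists y, S y /\ word (bits b y) J = word c J.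
  by move=> J; have [y Sy yc] := rc J; exists y.
have [x [Sx xc]] : S `&` cluster (y @ \oo) !=set0.
  by apply: cS; exists 0%N => // j _; exact: (yP j).1.
exists x; split=> // F J e /subspace_continuousP cF o z Sz zc.
apply/ler_addgt0Pr => r r0.
have := cF _ Sx; move=> /cvgrPdist_lt /(_ _ r0); rewrite near_withinE => nF.
have nJ : (y @ \oo) [set y' | S y' /\ word (bits b y') J = word c J].
  exists J => // j Jj /=; split; first exact: (yP j).1.
  exact: word_le Jj (yP j).2.
have [y' [[Sy' y'c] Fy']] := xc _ _ nJ nF.
rewrite -(subrKA (F y')) addrC; apply: le_trans (ler_normD _ _) _.
apply: lerD; last exact/ltW/Fy'.
by apply: o => //; rewrite y'c.
Qed.

End mesh.

(** Interleaving the two families puts the code of the first factor at the even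
positions and that of the second one at the odd positions. *)
Lemma mesh_prod (E1 E2 : topologicalType) S1 S2 b1 b2 :
  @mesh E1 S1 b1 -> @mesh E2 S2 b2 ->
  mesh (S1 `*` S2)
    (fun j => if odd j then snd @^-1` b2 j./2 else fst @^-1` b1 j./2).
Proof.
move=> m1 m2 [x1 x2] [/= Sx1 Sx2] N [[N1 N2] /= [xN1 xN2] N12].
have [[A1 B1] /= [xA1 [J1 _ JB1]] h1] := m1 _ Sx1 _ xN1.
have [[A2 B2] /= [xA2 [J2 _ JB2]] h2] := m2 _ Sx2 _ xN2.
(* a word of length J0 contains words of length [maxn J1 J2] of both factors *)
pose J0 := (maxn J1 J2).*2.
exists (A1 `*` A2, [set J | (J0 <= J)%N]).
  by split; [exists (A1, A2)|exists J0].
move=> [[y1 y2] J] [[/= A1y A2y] J0J] [/= Sy1 Sy2] [z1 z2] [/= Sz1 Sz2] /wordP yz.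
apply: N12; split=> /=.
- apply: (h1 (y1, maxn J1 J2)) => //=.
    by split=> //; apply: JB1 => /=; rewrite leq_maxl.
  apply/wordP => j jJ; have := yz j.*2; rewrite /bits odd_double doubleK.
  by apply; apply: leq_trans J0J; rewrite ltn_double.
- apply: (h2 (y2, maxn J1 J2)) => //=.
    by split=> //; apply: JB2 => /=; rewrite leq_maxr.
  apply/wordP => j jJ; have := yz j.*2.+1.
  rewrite /bits /= odd_double /= uphalf_double.
  by apply; apply: leq_trans J0J; rewrite /J0 ltn_Sdouble.
Qed.

End coding.

(** * Metrizable spaces *)

Section metrizable.
Context {R : realType}.

(** The balls of radius 1/(N+1) around a finite net, for all [N], are enumerated
in one sequence; a word long enough to contain the whole [N]th net locates the
point up to 2/(N+1). *)
Lemma metrizable_mesh (E : ptopologicalType) (S : set E) :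
  @metrizable R E -> compact S ->
  exists b : nat -> set E, (forall j, open (b j)) /\ mesh S b.
Proof.
move=> [d [d0 dC dT dN]] cS.
pose B x e : set E := [set y | d x y < e].
have Bx x e : 0 < e -> B x e x by rewrite /B /= (d0 x x).2.
have oB x e : open (B x e).
  rewrite openE => y /= xy; apply/dN; exists (e - d x y); first by rewrite subr_gt0.
  by move=> z /= yz; rewrite /B /= (le_lt_trans (dT x y z))// -ltrBrDl.
have /choice[c cP] N : exists c : seq E, forall x, S x ->
    exists2 j, (j < size c)%N & exists2 y, onth c j = Some y & B y N.+1%:R^-1 x.
  have N0 : 0 < N.+1%:R^-1 :> R by rewrite invr_gt0.
  have := cS; rewrite compact_cover => /(_ E S (fun x => B x N.+1%:R^-1)) [].
  - by move=> x _; exact: oB.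
  - by move=> x Sx; exists x => //; exact: Bx.
  move=> D DS SD; exists (enum_fset D) => x /SD [y yD yx].
  have /onthP[j jy] := yD; exists j; last by exists y.
  by rewrite -onthTE jy.
pose ball_of N j := if onth (c N) j is Some y then B y N.+1%:R^-1 else set0.
exists (fun k => if unpickle k is Some (N, j) then ball_of N j else set0).
split=> [k|x Sx O xO].
  case: unpickle => [[N j]|]; last exact: open0.
  by rewrite /ball_of; case: onth => [y|]; [exact: oB|exact: open0].
have [e e0 eO] : exists2 e, 0 < e & [set y | d x y < e] `<=` O := (dN _ _).1 xO.
have [N Ne] : exists N : nat, N.+1%:R^-1 < e / 3.
  have /ltr_add_invr[N] : 0 < e / 3 by rewrite divr_gt0.
  by rewrite add0r; exists N.
(* beyond J0, words decide membership in every ball of the Nth net *)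
pose J0 := (\max_(j < size (c N)) pickle (N, j : nat)).+1.
exists (B x (e / 3), [set J | (J0 <= J)%N]); first split => /=.
- by apply/dN; exists (e / 3) => //; rewrite divr_gt0.
- by exists J0.
move=> [y J] /= [xy J0J] Sy z Sz /wordP yz; apply: eO => /=.
have [j jc [a cj ay]] := cP N y Sy.
have := yz (pickle (N, j)); rewrite /bits /= pickleK /ball_of cj.
rewrite (leq_trans _ J0J) ?ltnS; last first.
  exact: (@leq_bigmax _ (fun i : 'I_(size (c N)) => pickle (N, i : nat)) (Ordinal jc)).
move=> /(_ isT); rewrite (asboolT ay) => /esym/asboolP az.
apply: le_lt_trans (dT x y z) _; rewrite (_ : e = e / 3 + (e / 3 + e / 3)); last by field.
apply: ltrD => //; apply: le_lt_trans (dT y a z) _.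
by apply: ltrD; [rewrite dC|]; exact: lt_trans Ne.
Qed.

(** The distance to the complement of [O]. *)
Lemma metrizable_cozero (E : topologicalType) (O : set E) :
  @metrizable R E -> open O ->
  exists D : E -> R, [/\ continuous D, forall x, 0 <= D x &
    forall x, O x <-> 0 < D x].
Proof.
move=> [d [d0 dC dT dN]] oO.
have dge0 x y : 0 <= d x y.
  have := dT x y x; rewrite (d0 x x).2// (dC y x) -mulr2n.
  by rewrite pmulrn_lge0.
have [OT|OT] := pselect (forall x, O x).
  by exists (cst 1); split=> // x; exact: cvg_cst.
have [x0 nOx0] : exists x, ~ O x by apply/existsNP.
pose A x := [set d x y | y in ~` O].
have A0 x : A x !=set0 by exists (d x x0), x0.
have Alb x : has_lbound (A x) by exists 0 => _ [y _ <-].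
have lip x y : inf (A x) - inf (A y) <= d x y.
  rewrite lerBlDr -lerBlDl; apply: lb_le_inf => // _ [z nOz <-].
  rewrite lerBlDl; apply: le_trans (dT x y z); apply: ge_inf => //.
  by exists z.
exists (fun x => inf (A x)); split.
- move=> x; apply/cvgrPdist_lt => e e0.
  have : nbhs x [set y | d x y < e] by apply/dN; exists e.
  apply: filterS => y /= xy; apply: le_lt_trans xy.
  by rewrite ler_norml lip andbT lerNl opprB dC lip.
- by move=> x; apply: lb_le_inf => // _ [y _ <-].
move=> x; split=> [Ox|iA].
  have : nbhs x O by move: oO; rewrite openE; exact.
  move=> /dN[e e0 eO]; apply: lt_le_trans e0 _.
  apply: lb_le_inf => // _ [y nOy <-]; rewrite leNgt; apply/negP => xy.
  exact/nOy/eO.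
apply: contrapT => nOx; move: iA; rewrite ltNge => /negP; apply.
by apply: ge_inf => //; exists x => //; exact/d0.
Qed.

(** Open sets are preimages of half-lines under continuous functions, so Borel
measurability of a map into a metrizable space can be tested by composition with
continuous real functions. *)
Lemma measurable_fun_borel d (T : measurableType d) (E : ptopologicalType)
    (D : set T) (f : T -> E) : @metrizable R E -> measurable D ->
  (forall F : E -> R, continuous F -> measurable_fun D (F \o f)) ->
  measurable_fun D (f : T -> borel E).
Proof.
move=> mE mD mf.
apply: (@measurability _ _ _ (borel E) _ _ (open : set (set E))) => //.
move=> _ [V oV <-]; have [F [cF F0 FO]] := metrizable_cozero mE oV.
rewrite (_ : f @^-1` V = (F \o f) @^-1` `]0, +oo[%classic); last first.
  by apply/seteqP; split=> x /=; rewrite in_itv /= andbT FO.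
by apply: mf.
Qed.

Lemma continuous_borel_fun (E : ptopologicalType) (F : E -> R) :
  continuous F -> measurable_fun [set: borel E] F.
Proof.
move=> cF; apply: (@measurability _ _ (borel E) (measurableTypeR R) _ _
    (@RGenOpens.G R)); first exact: RGenOpens.measurableE.
move=> _ [_ [a [b ->]] <-]; rewrite setTI; apply: sub_sigma_algebra.
move: cF => /continuousP; apply; exact: interval_open.
Qed.

End metrizable.

(** * Additive weights on the binary tree and subdivision of an interval *)

Section tree.
Context {R : realType}.
Implicit Type a : seq bool -> R.

Definition tree_mass a := (forall v, 0 <= a v) /\
  forall v, a v = a (rcons v false) + a (rcons v true).

(** The interval [0, a nil[ is cut according to the weights of the words of length
1, each piece is cut again, and so on.  [walk a t J] is the word of length [J]
whose piece contains [t], with the left end of that piece. *)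
Fixpoint walk a (t : R) J : seq bool * R :=
  if J is J'.+1 then
    let: (v, l) := walk a t J' in
    if t < l + a (rcons v false) then (rcons v false, l)
    else (rcons v true, l + a (rcons v false))
  else ([::], 0).

Definition route a t j : bool := last false (walk a t j.+1).1.

Lemma word_route a t J : word (route a t) J = (walk a t J).1.
Proof.
elim: J => // J IH; rewrite /word mkseqS -/(word _ _) IH /route /=.
by case: (walk a t J) => v l; case: ifP => _ /=; rewrite last_rcons.
Qed.

Lemma walk_itv a t J : tree_mass a -> 0 <= t < a [::] ->
  (walk a t J).2 <= t < (walk a t J).2 + a (walk a t J).1.
Proof.
move=> [a0 aD] t0; elim: J => [|J] /=; first by rewrite add0r.
case: (walk a t J) => v l /= /andP[lt tl]; case: ltP => /= h.
  by rewrite lt.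
by rewrite h /= -addrA -aD.
Qed.

(** The left end of the piece of [v] is the sum of the weights of the words that
precede [v]; recording that [walk] stops at that very number is what carries the
induction. *)
Lemma route_itv a v : tree_mass a -> exists l, [/\ 0 <= l,
    l + a v <= a [::] & forall t, 0 <= t < a [::] ->
  (word (route a t) (size v) = v <-> l <= t < l + a v) /\
  (word (route a t) (size v) = v -> (walk a t (size v)).2 = l)].
Proof.
move=> am; have [a0 aD] := am; elim/last_ind: v => [|v b [l [l0 lv IH]]].
  by exists 0; rewrite add0r; split=> // t t0; rewrite t0; split.
exists (if b then l + a (rcons v false) else l); split.
- by case: b; rewrite ?addr_ge0.
- apply: le_trans lv; rewrite (aD v); case: b; first by rewrite addrA.
  by rewrite lerD2l lerDl.
move=> t t0.
have {IH}[IH1 IH2] := IH t t0.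
have := walk_itv (size v) am t0; move: IH1 IH2.
rewrite !word_route size_rcons /=; case: (walk a t (size v)) => w k /= IH1 IH2 wk.
split; last first.
  case: ifP => /= tk /rcons_inj[wv] <-; subst w; by rewrite IH2.
split.
  case: ifP => /= tk /rcons_inj[wv] <-; subst w; rewrite -IH2//.
    by rewrite tk; case/andP: wk => ->.
  by rewrite -addrA -aD leNgt tk/=; case/andP: wk.
have [wv|wv] := pselect (w = v).
  rewrite -wv in IH2 *; rewrite -(IH2 erefl); case: b => /andP[h1 h2].
    by rewrite ltNge h1.
  by rewrite h2.
move=> h; case: wv; apply/IH1; move: h; case: b => /andP[h1 h2].
  rewrite (le_trans _ h1)/=; last by rewrite lerDl.
  by rewrite (lt_le_trans h2)// -addrA -aD.
by rewrite h1/= (lt_le_trans h2)// lerD2l [leRHS]aD lerDl.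
Qed.

Lemma route_cell a v : tree_mass a -> exists l,
  [set t | 0 <= t < a [::]] `&` [set t | word (route a t) (size v) = v] =
  `[l, l + a v[%classic.
Proof.
move=> am; have [l [l0 lv h]] := route_itv v am; exists l.
apply/seteqP; split=> t /=; rewrite in_itv /=.
  by move=> [t0 /(h _ t0).1].
move=> ltv; have t0 : 0 <= t < a [::].
  case/andP: ltv => lt tl; rewrite (le_trans l0 lt)/=.
  exact: lt_le_trans tl lv.
by split=> //; apply/(h _ t0).1.
Qed.

(** The pieces are half-open, hence a nonempty piece has positive length: only
words of positive weight are ever met. *)
Lemma route_gt0 a t J : tree_mass a -> 0 <= t < a [::] ->
  0 < a (word (route a t) J).
Proof.
move=> am t0; rewrite word_route; have /andP[h1 h2] := walk_itv J am t0.
by have := le_lt_trans h1 h2; rewrite ltrDl.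
Qed.

End tree.

(** * Integrals over code cells *)

Section bounded_integrals.
Context {R : realType} d (T : measurableType d).
Variable lam : {measure set T -> \bar R}.
Variable D : set T.
Hypothesis mD : measurable D.

Lemma integrable_mul_bounded (h rho : T -> R) M : measurable_fun D h ->
  (forall x, D x -> `|h x| <= M) -> lam.-integrable D (EFin \o rho) ->
  lam.-integrable D (EFin \o (fun x => h x * rho x)).
Proof.
move=> mh hM irho; apply: (@integrableMr _ _ _ lam D mD h (EFin \o rho)) => //.
exists M; split; first exact: num_real.
by move=> N MN x Dx; apply: le_trans (hM _ Dx) _; exact: ltW.
Qed.

Lemma Rintegral_sum (I : Type) (s : seq I) (h : I -> T -> R) :
  (forall i, lam.-integrable D (EFin \o h i)) ->
  \int[lam]_(x in D) (\sum_(i <- s) h i x) =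
  \sum_(i <- s) \int[lam]_(x in D) h i x.
Proof.
move=> ih; rewrite /Rintegral; under eq_integral do rewrite -sumEFin.
rewrite (integral_sum mD ih) sum_fine//.
by move=> i _; apply: integrable_fin_num => //; exact: ih.
Qed.

End bounded_integrals.

Section cells.
Context {R : realType} d (T : measurableType d).
Variables (lam : {measure set T -> \bar R}) (D : set T).
Hypothesis mD : measurable D.
Variable c : T -> nat -> bool.
Hypothesis mc : forall j, measurable (D `&` [set t | c t j]).

Definition cell (v : seq bool) : set T :=
  D `&` [set t | word (c t) (size v) = v].

Lemma measurable_cell v : measurable (cell v).
Proof.
elim/last_ind: v => [|v b IH].
  by rewrite (_ : cell _ = D)//; apply/seteqP; split=> [t []|].
rewrite (_ : cell _ =
    cell v `&` (if b then D `&` [set t | c t (size v)]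
                else D `\` (D `&` [set t | c t (size v)]))).
  by apply: measurableI => //; case: b => //; exact: measurableD.
apply/seteqP; rewrite /cell size_rcons; split=> t /=; rewrite /word mkseqS.
  move=> [Dt /rcons_inj[-> ctb]]; split=> //.
  by move: ctb; case: b => /= -> //; split=> // -[].
move=> [[Dt ->]]; case: b => /= -[_ h]; split=> //; first by rewrite h.
by congr rcons; apply/negP => ct; exact: h.
Qed.

(** A function of the first [J] digits is a finite combination of indicators of
cells. *)
Lemma word_cellE (Y : seq bool -> R) J t : D t ->
  Y (word (c t) J) = \sum_(v : J.-tuple bool) Y v * \1_(cell v) t.
Proof.
move=> Dt; have sw : size (word (c t) J) == J by rewrite size_mkseq.
rewrite (bigD1 (Tuple sw))//= big1 ?addr0 => [|v vw].
  by rewrite indicE mem_set ?mulr1//; split=> //=; rewrite size_mkseq.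
rewrite indicE memNset ?mulr0// => -[_ /= cv]; move: vw => /eqP; apply.
by apply: val_inj => /=; rewrite -cv size_tuple.
Qed.

Lemma measurable_word (Y : seq bool -> R) J :
  measurable_fun D (fun t => Y (word (c t) J)).
Proof.
apply: (@eq_measurable_fun _ _ _ _ D
  (fun t => \sum_(v : J.-tuple bool) Y v * \1_(cell v) t)).
  by move=> t /[!inE] Dt; rewrite -word_cellE.
apply: measurable_sum => v; apply: measurable_funM => //.
by apply: measurable_indic; exact: measurable_cell.
Qed.

Lemma Rintegral_word (Y : seq bool -> R) J (rho : T -> R) :
  lam.-integrable D (EFin \o rho) ->
  \int[lam]_(t in D) (Y (word (c t) J) * rho t) =
  \sum_(v : J.-tuple bool) Y v * \int[lam]_(t in cell v) rho t.
Proof.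
move=> irho.
have i1 (v : J.-tuple bool) :
    lam.-integrable D (EFin \o (fun t => \1_(cell v) t * rho t)).
  apply: (@integrable_mul_bounded _ _ _ _ _ _ _ _ 1) => //.
    by apply: measurable_indic; exact: measurable_cell.
  by move=> t _; rewrite indicE; case: (t \in _); rewrite ?normr1 ?normr0.
transitivity (\int[lam]_(t in D)
    \sum_(v : J.-tuple bool) Y v * (\1_(cell v) t * rho t)).
  apply: eq_Rintegral => t /[!inE] Dt; rewrite word_cellE// mulr_suml.
  by apply: eq_bigr => v _; rewrite mulrA.
rewrite Rintegral_sum//; last first.
  move=> v; apply: (@integrable_mul_bounded _ _ _ _ _ _ (cst (Y v)) _ `|Y v|) => //.
apply: eq_bigr => v _; rewrite RintegralZl//; congr (_ * _).
have -> : cell v = D `&` cell v by rewrite setIA setIid.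
rewrite [RHS]Rintegral_mkcondr; apply: eq_Rintegral => t _.
rewrite patchE indicE in_setI; case: ifPn => tv; last by rewrite andbF mul0r.
by rewrite andbT mem_set ?mul1r//; case: (set_mem tv).
Qed.

End cells.

(** * Diagonal extraction *)

Section diagonal.
Context {R : realType}.

(** The sequence lives in a compact product of intervals, hence has a cluster
point [l].  As [I] is countable, [l] can be reached by a subsequence: the [k]th
term is 1/(k+1)-close to [l] at the indices of rank at most [k]. *)
Lemma diagonal_extraction (I : countType) (x : nat -> I -> R) (M : R) :
  (forall k i, `|x k i| <= M) ->
  exists phi (l : I -> R), increasing_seq phi /\
    forall i, x (phi k) i @[k --> \oo] --> l i.
Proof.
move=> xM.
have cM : compact [set f : prod_topology (fun _ : I => R) | forall i, `[- M, M]%classic (f i)].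
  by apply: (@tychonoff I (fun=> R) (fun=> `[- M, M]%classic)) => _; exact: segment_compact.
have [l [_ lx]] : [set f : prod_topology (fun _ : I => R) | forall i, `[- M, M]%classic (f i)]
    `&` cluster ((x : nat -> prod_topology (fun _ : I => R)) @ \oo) !=set0.
  apply: cM; exists 0%N => // k _ i /=; rewrite in_itv /= -ler_norml; exact: xM.
have pick k N : exists2 j, (N < j)%N & forall i : I, (pickle i <= k)%N ->
    `|l i - x j i| < k.+1%:R^-1.
  pose V : set (prod_topology (fun _ : I => R)) :=
    [set f | forall i : I, (pickle i <= k)%N -> `|l i - f i| < k.+1%:R^-1].
  have nV : nbhs l V.
    have h (i : I) : nbhs l [set f : prod_topology (fun _ : I => R) | `|l i - f i| < k.+1%:R^-1].
      have nB : nbhs (l i) [set y | `|l i - y| < k.+1%:R^-1].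
        by apply/nbhs_ballP; exists k.+1%:R^-1 => //=; rewrite invr_gt0.
      exact: (@proj_continuous I (fun=> R) i l _ nB).
    suff : forall K, nbhs l [set f : prod_topology (fun _ : I => R) |
        forall i : I, (pickle i < K)%N -> `|l i - f i| < k.+1%:R^-1] by move=> h2; exact: (h2 k.+1).
    elim=> [|K IH]; first exact: filterE.
    have [[i iK]|nK] := pselect (exists i : I, pickle i = K).
      apply: filterS2 IH (h i) => f fK fi i'; rewrite ltnS leq_eqVlt.
      case/orP => [/eqP i'K|]; last exact: fK.
      by rewrite (_ : i' = i)//; apply: (pcan_inj pickleK); rewrite iK.
    apply: filterS IH => f fK i; rewrite ltnS leq_eqVlt => /orP[/eqP iK|].
      by case: nK; exists i.
    exact: fK.
  have nN : ((x : nat -> prod_topology (fun _ : I => R)) @ \oo)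
      [set f | exists2 j, (N < j)%N & f = x j].
    by exists N.+1 => // j /= Nj; exists j.
  by have [f [[j Nj ->] Vj]] := lx _ _ nN nV; exists j.
have /choice[nxt nxtP] kN : exists j, (kN.2 < j)%N /\ forall i : I, (pickle i <= kN.1)%N ->
    `|l i - x j i| < kN.1.+1%:R^-1.
  by have [j ? ?] := pick kN.1 kN.2; exists j.
pose phi := fix phi k := if k is k'.+1 then nxt (k, phi k') else nxt (0%N, 0%N).
have phiP k i : (pickle i <= k)%N -> `|l i - x (phi k) i| < k.+1%:R^-1.
  by case: k => [|k]; [exact: (nxtP (_, _)).2|exact: (nxtP (_, _)).2].
exists phi, l; split.
  by apply/increasing_seqP => k; exact: (nxtP (_, _)).1.
move=> i; apply/cvgrPdist_lt => e e0; near=> k.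
apply: lt_trans (phiP k i _) _; first by near: k; exists (pickle i).
by near: k; exact: near_infty_natSinv_lt (PosNum e0).
Unshelve. all: by end_near. Qed.

End diagonal.

(** * Approximation of integrals by sums over cells *)

Section sampling.
Context {R : realType} (E : ptopologicalType) (S : set E) (b : nat -> set E).
Hypotheses (cS : compact S) (mS : mesh S b).

(** A point of [S] in the cell of the word [v], an arbitrary point when that cell
is empty. *)
Definition cell_point (v : seq bool) : E :=
  get [set y | S y /\ word (bits b y) (size v) = v].

Lemma bounded_within (F : E -> R) : {within S, continuous F} ->
  exists M, forall x, S x -> `|F x| <= M.
Proof.
move=> cF; have [|M [_ MP]] := @compact_bounded R R (F @` S).
  exact: continuous_compact.
exists (M + 1) => x Sx; apply: (MP (M + 1)); first by rewrite ltrDl.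
by exists x.
Qed.

Section sample.
Context d (T : measurableType d).
Variables (lam : {measure set T -> \bar R}) (D : set T).
Hypothesis mD : measurable D.
Variables (c : T -> nat -> bool) (z : T -> E).
Hypothesis mc : forall j, measurable (D `&` [set t | c t j]).
Hypothesis zc : forall t, D t -> @decodes R E S b (z t) (c t).

Lemma sample_dist (F : E -> R) J (e : R) t : {within S, continuous F} ->
  osc_le S b F J e -> D t -> `|F (z t) - F (cell_point (word (c t) J))| <= e.
Proof.
move=> cF o Dt; have [Sz rz h] := zc Dt.
have [y Sy yJ] := rz J.
have : [set y | S y /\ word (bits b y) (size (word (c t) J)) = word (c t) J]
    (cell_point (word (c t) J)).
  by apply: getPex; exists y; rewrite /= size_mkseq.
by rewrite /= size_mkseq => -[Sr rJ]; exact: (h F J e).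
Qed.

(** [F \o z] is the pointwise limit of functions of finitely many digits. *)
Lemma measurable_sample (F : E -> R) : {within S, continuous F} ->
  measurable_fun D (F \o z).
Proof.
move=> cF; have /choice[J JP] k : exists J, osc_le S b F J k.+1%:R^-1.
  by apply: mesh_osc_le => //; rewrite invr_gt0.
apply: (@measurable_fun_cvg _ _ _ D
  (fun k t => F (cell_point (word (c t) (J k))))) => [k|t Dt].
  exact: (measurable_word mD mc (F \o cell_point)).
apply/cvgrPdist_lt => e e0; near=> k.
apply: le_lt_trans (sample_dist cF (JP k) Dt) _.
by near: k; exact: near_infty_natSinv_lt (PosNum e0).
Unshelve. all: by end_near. Qed.

(** On each cell [F \o z] is [e]-close to a constant.  The points [z t] only have to
decode the codes [c t]; thus the estimate applies both to given maps, with their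
own codes, and to maps built by decoding prescribed codes. *)
Lemma sample_sum (F : E -> R) J (e : R) (rho : T -> R) :
  {within S, continuous F} -> osc_le S b F J e ->
  (forall t, D t -> 0 <= rho t) -> lam.-integrable D (EFin \o rho) ->
  `|\int[lam]_(t in D) (F (z t) * rho t) -
    \sum_(v : J.-tuple bool) F (cell_point v) * \int[lam]_(t in cell D c v) rho t|
  <= e * \int[lam]_(t in D) rho t.
Proof.
move=> cF o rho0 irho; have [M MP] := bounded_within cF.
pose Y v := F (cell_point v).
rewrite -(Rintegral_word mD mc Y)//.
have i1 : lam.-integrable D (EFin \o (fun t => F (z t) * rho t)).
  apply: (@integrable_mul_bounded _ _ _ _ _ _ (F \o z) _ M) => //.
    exact: measurable_sample.
  by move=> t /zc[Sz _ _]; exact: MP.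
have i2 : lam.-integrable D (EFin \o (fun t => Y (word (c t) J) * rho t)).
  apply: (@integrable_mul_bounded _ _ _ _ _ _ (fun t => Y (word (c t) J)) _ (M + e)) => //.
    exact: measurable_word.
  move=> t Dt; have := sample_dist cF o Dt; rewrite -/(Y _) distrC => h.
  have [Sz _ _] := zc Dt; rewrite -(subrK (F (z t)) (Y _)) addrC.
  by apply: le_trans (ler_normD _ _) _; rewrite lerD// MP.
rewrite -RintegralB//.
have i3 : lam.-integrable D
    (EFin \o (fun t => F (z t) * rho t - Y (word (c t) J) * rho t)).
  exact: (integrableB mD i1 i2).
apply: le_trans (le_normr_Rintegral _ _) _ => //.
rewrite -RintegralZl//; apply: le_Rintegral => //.
- exact: integrable_norm.
- exact: (integrableZl mD e irho).
- move=> t Dt; rewrite -mulrBl normrM (ger0_norm (rho0 _ Dt)).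
  by rewrite ler_wpM2r ?rho0//; exact: sample_dist.
Qed.

End sample.

End sampling.

(** * Weak limits *)

Section tree_law.
Context {R : realType} (E : ptopologicalType) (S : set E) (b : nat -> set E).
Hypotheses (cS : compact S) (mS : @mesh E S b).
Variable a : seq bool -> R.
Hypotheses (am : tree_mass a)
  (ab : forall v, 0 < a v -> exists2 y, S y & word (bits b y) (size v) = v).

Let D : set (measurableTypeR R) := `[0, a [::][%classic.

Lemma lebesgue_route v :
  measurable (cell D (route a) v : set (measurableTypeR R)) /\
  lebesgue_measure (cell D (route a) v) = (a v)%:E.
Proof.
have [l lE] := route_cell v am.
have cE : cell D (route a) v = `[l, l + a v[%classic.
  rewrite -lE; apply/seteqP; split=> t /=; rewrite /cell /D /= in_itv /=; exact.
split; first by rewrite cE; exact: measurable_itv.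
rewrite cE lebesgue_measure_itv /= lte_fin ltrDl.
have := am.1 v; rewrite le_eqVlt => /predU1P[<-|->]; first by rewrite ltxx.
by rewrite -EFinB addrAC subrr add0r.
Qed.

(** The image of Lebesgue measure under [chi] realizes the weight: [chi t] decodes the code that the
subdivision of the interval attaches to [t]. *)
Lemma tree_law : exists chi : measurableTypeR R -> E,
  (forall t, 0 <= t < a [::] -> S (chi t)) /\
  forall F : E -> R, {within S, continuous F} ->
    measurable_fun D (F \o chi) /\
    forall J (e : R), osc_le S b F J e ->
      `|\int[lebesgue_measure]_(t in D) F (chi t) -
        \sum_(v : J.-tuple bool) F (cell_point S b v) * a v| <= e * a [::].
Proof.
have mD : measurable D by exact: measurable_itv.
(* the jth digit is 1 on a countable union of cells, those of the words of
   length j + 1 that end with 1 *)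
have mc j : measurable (D `&` [set t | route a t j]).
  rewrite (_ : _ `&` _ = \bigcup_v (if (size v == j.+1) && last false v
      then cell D (route a) v else set0)).
    apply: countable_bigcupT_measurable; first exact: countableP.
    by move=> v; case: ifP => // _; exact: (lebesgue_route v).1.
  apply/seteqP; split=> t /=.
    move=> [Dt tj]; exists (word (route a t) j.+1) => //.
    have -> : last false (word (route a t) j.+1) = true.
      by rewrite /word mkseqS last_rcons.
    by rewrite size_mkseq eqxx; split=> //; rewrite /mkset size_mkseq.
  move=> [v _]; case: ifP => // /andP[/eqP sv lv] [Dt /=]; rewrite sv => cv.
  by split=> //; move: lv; rewrite -cv /word mkseqS last_rcons.
have /choice[chi chiP] (t : measurableTypeR R) : exists x, D t -> @decodes R E S b x (route a t).
  have [Dt|nDt] := pselect (D t); last by exists point.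
  have [|x xP] := @exists_decoding R E S b (route a t) cS; last by exists x.
  move=> J; have t0 : 0 <= t < a [::] by move: Dt; rewrite /D /= in_itv.
  have [y Sy] := ab (route_gt0 J am t0); rewrite size_mkseq => yJ.
  by exists y.
exists chi; split.
  by move=> t t0; have [] := chiP t; rewrite // /D /= in_itv.
move=> F cF; split; first exact: (measurable_sample cS mS mD mc chiP cF).
move=> J e o.
have leb1 A : measurable (A : set (measurableTypeR R)) ->
    \int[lebesgue_measure]_(t in A) (cst 1 t : R) = fine (lebesgue_measure A).
  by move=> mA; rewrite Rintegral_cst// mul1r.
have DE : lebesgue_measure D = (a [::])%:E.
  rewrite -(lebesgue_route [::]).2; congr (_ _).
  by apply/seteqP; split=> [t Dt|t []].
have i1 : lebesgue_measure.-integrable D (EFin \o cst (1 : R)).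
  have Dy : (lebesgue_measure D < +oo)%E by rewrite DE ltry.
  apply: (measurable_bounded_integrable mD Dy) => //.
  exists 1; split; first exact: num_real.
  by move=> M M1 x _ /=; rewrite normr1 ltW.
have := sample_sum cS mS mD mc chiP cF o (fun _ _ => ler01) i1.
rewrite leb1// DE /=; congr (`| _ - _ | <= _).
  by apply: eq_Rintegral => t _; rewrite mulr1.
apply: eq_bigr => v _; have [mv vE] := lebesgue_route v.
by rewrite leb1// vE.
Qed.

End tree_law.

Section cell_mass.
Context {R : realType} d (T : measurableType d).
Variables (lam : {measure set T -> \bar R}) (D : set T).
Hypothesis mD : measurable D.
Variable c : T -> nat -> bool.
Hypothesis mc : forall j, measurable (D `&` [set t | c t j]).
Variable rho : T -> R.
Hypotheses (rho0 : forall t, D t -> 0 <= rho t)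
  (irho : lam.-integrable D (EFin \o rho)).

Lemma tree_mass_cell :
  tree_mass (fun v => \int[lam]_(t in cell D c v) rho t).
Proof.
split=> v; first by apply: Rintegral_ge0 => t [Dt _]; exact: rho0.
have vE : cell D c v = cell D c (rcons v false) `|` cell D c (rcons v true).
  apply/seteqP; rewrite /cell !size_rcons /word; split=> t /=.
    move=> [Dt tv]; rewrite mkseqS tv.
    by case: (c t (size v)); [right|left].
  by move=> [|] [Dt]; rewrite mkseqS => /rcons_inj[-> _].
rewrite {1}vE Rintegral_setU//; [exact: measurable_cell..| |].
  by rewrite -vE; apply: integrableS irho => //; [exact: measurable_cell|move=> t []].
apply/disj_setPS => t [] [_ /=]; rewrite !size_rcons => tf [_ /=].
by rewrite size_rcons tf => /rcons_inj[].
Qed.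

Lemma tree_mass_le (a : seq bool -> R) v : tree_mass a -> a v <= a [::].
Proof.
move=> [a0 aD]; elim/last_ind: v => // v b; apply: le_trans; rewrite [leRHS]aD.
by case: b; [rewrite lerDr|rewrite lerDl].
Qed.

End cell_mass.

(** Sequential weak compactness of the image measures of [rho k * lam] under [z k].
The masses of the cells converge along a subsequence, and additivity passes to
the limit.  A cell of positive limit mass has positive mass for some [k], so that
it is inhabited and [tree_law] applies.  The limit is presented by a map on an
interval: this form gives a joint law for maps with values in a product. *)
Lemma weak_limit (R : realType) (E : ptopologicalType) (S : set E)
    (b : nat -> set E) d (T : measurableType d)
    (lam : {measure set T -> \bar R}) (D : set T)
    (z : nat -> T -> E) (rho : nat -> T -> R) (M : R) :
  compact S -> mesh S b -> measurable D ->
  (forall k t, D t -> S (z k t)) ->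
  (forall k j, measurable (D `&` z k @^-1` b j)) ->
  (forall k t, D t -> 0 <= rho k t) ->
  (forall k, lam.-integrable D (EFin \o rho k)) ->
  (forall k, \int[lam]_(t in D) rho k t <= M) ->
  exists phi (m : R) (chi : measurableTypeR R -> E),
  [/\ increasing_seq phi, forall t, 0 <= t < m -> S (chi t) &
    forall F : E -> R, {within S, continuous F} ->
      measurable_fun `[0, m[%classic (F \o chi) /\
      \int[lam]_(t in D) (F (z (phi k) t) * rho (phi k) t) @[k --> \oo] -->
      \int[lebesgue_measure]_(t in `[0, m[%classic) F (chi t)].
Proof.
move=> cS mS mD zS mz rho0 irho rhoM.
pose c k t := bits b (z k t).
have mc k j : measurable (D `&` [set t | c k t j]).
  rewrite (_ : [set t | _] = z k @^-1` b j)//.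
  by apply/seteqP; split=> t /= /asboolP.
pose mass k v := \int[lam]_(t in cell D (c k) v) rho k t.
have tm k : tree_mass (mass k) by exact: (tree_mass_cell mD (mc k) (rho0 k) (irho k)).
have massD k : mass k [::] = \int[lam]_(t in D) rho k t.
  by rewrite /mass (_ : cell _ _ _ = D)//; apply/seteqP; split=> [t []|].
have massM k v : `|mass k v| <= M.
  rewrite ger0_norm ?(tm k).1//; apply: le_trans (rhoM k).
  by rewrite -massD; exact: tree_mass_le.
have [phi [a [iphi acv]]] := diagonal_extraction massM.
have am : tree_mass a.
  split=> v.
    apply: (cvgr_to_ge (acv v)) => //; apply: nearW => k; exact: (tm _).1.
  have := acv v; under eq_fun do rewrite (tm _).2.
  move=> /(cvg_unique (@Rhausdorff R)); apply.
  by apply: cvgD; exact: acv.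
have ab v : 0 < a v -> exists2 y, S y & word (bits b y) (size v) = v.
  move=> av; have [k] : exists k, 0 < mass (phi k) v.
    have /cvgrPdist_lt /(_ _ av) := acv v; case=> k _ /(_ k (leqnn k)) /=.
    move=> h; exists k; rewrite lt_neqAle (tm _).1 andbT; apply/eqP => m0.
    by move: h; rewrite -m0 subr0 gtr0_norm// ltxx.
  have [c0|/set0P[t [Dt tv]]] := eqVneq (cell D (c (phi k)) v) set0.
    by rewrite /mass c0 Rintegral_set0 ltxx.
  by move=> _; exists (z (phi k) t) => //; exact: zS.
have [chi [chiS chiF]] := tree_law cS mS am ab.
exists phi, (a [::]), chi; split=> //.
move=> F cF; have [mF hF] := chiF F cF; split=> //.
have aM : a [::] <= M.
  apply: (cvgr_to_le (acv [::])) => //; apply: nearW => k.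
  by apply: le_trans (ler_norm _) _; exact: massM.
apply/cvgrPdist_le => e e0.
have M0 : 0 < M + 1 by rewrite (le_lt_trans (am.1 [::]))// ltr_pwDr.
(* with oscillation e', the errors of the two cell sums, of the kth integral and
   of the limit integral, are at most e / 3 each; the last third is for the
   convergence of the cell masses *)
pose e' := e / 3 / (M + 1).
have e'0 : 0 < e' by rewrite !divr_gt0.
have e'M x : x <= M -> e' * x <= e / 3.
  move=> xM; rewrite /e' -mulrA ger_pMr ?divr_gt0// mulrC ler_pdivrMr// mul1r.
  by rewrite (le_trans xM)// lerDl.
have [J o] := mesh_osc_le cS mS cF e'0.
have cvs : \sum_(v : J.-tuple bool) F (cell_point S b v) * mass (phi k) v @[k --> \oo] -->
    \sum_(v : J.-tuple bool) F (cell_point S b v) * a v.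
  apply: cvg_big => [|v _]; first exact: add_continuous.
  apply: cvgM; [exact: cvg_cst|exact: acv].
move/cvgrPdist_le : cvs => /(_ (e / 3)); rewrite divr_gt0// => /(_ isT).
apply: filterS => k hk.
have zc t : D t -> @decodes R E S b (z (phi k) t) (c (phi k) t).
  by move=> Dt; apply: decodes_bits; exact: zS.
have h1 := le_trans (sample_sum cS mS mD (mc (phi k)) zc cF o (rho0 (phi k))
  (irho (phi k))) (e'M _ (rhoM (phi k))).
have h2 := le_trans (hF _ _ o) (e'M _ aM).
move: hk h1 h2; rewrite /mass !ler_norml.
move=> /andP[? ?] /andP[? ?] /andP[? ?]; apply/andP; split; lra.
Qed.

(** * Laws of maps *)

Section laws.
Context {R : realType}.

Lemma integrable_bounded d (T : measurableType d)
    (mu : {finite_measure set T -> \bar R}) (D : set T) (h : T -> R) (M : R) :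
  measurable D -> measurable_fun D h -> (forall t, D t -> `|h t| <= M) ->
  mu.-integrable D (EFin \o h).
Proof.
move=> mD mh hM; apply: (measurable_bounded_integrable mD) => //.
  by rewrite ltey_eq fin_num_measure.
exists M; split; first exact: num_real.
by move=> N MN t Dt /=; apply: le_trans (hM t Dt) _; exact: ltW.
Qed.

Lemma EFin_Rintegral d (T : measurableType d)
    (mu : {measure set T -> \bar R}) (D : set T) (h : T -> R) :
  measurable D -> mu.-integrable D (EFin \o h) ->
  (\int[mu]_(t in D) h t)%:E = (\int[mu]_(t in D) (h t)%:E)%E.
Proof. by move=> mD ih; rewrite /Rintegral fineK//; exact: (integrable_fin_num mD ih). Qed.

Lemma norm_Rintegral_probability d (T : measurableType d)
    (P : probability T R) (h : T -> R) (M : R) :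
  measurable_fun setT h -> (forall t, `|h t| <= M) ->
  `|\int[P]_t h t| <= M.
Proof.
move=> mh hM.
have ih : P.-integrable setT (EFin \o h).
  by apply: (@integrable_bounded _ _ _ _ _ M) => // t _; exact: hM.
have iM : P.-integrable setT (EFin \o cst M).
  by apply: (@integrable_bounded _ _ _ _ _ `|M|).
apply: le_trans (le_normr_Rintegral measurableT ih) _.
apply: le_trans (le_Rintegral measurableT (integrable_norm ih) iM _) _.
  by move=> t _; exact: hM.
by rewrite Rintegral_cst// [X in fine X]probability_setT mulr1.
Qed.

(** Image measures of maps that are measurable on [D] only: the map is extended by
a constant outside [D], which the restriction of [mu] to [D] does not charge. *)
Lemma restricted_law d (T : measurableType d)
    (mu : {measure set T -> \bar R}) (D : set T) d' (Y : measurableType d')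
    (f : T -> Y) :
  measurable D -> (mu D < +oo)%E -> measurable_fun D f ->
  exists nu : {finite_measure set Y -> \bar R},
    (forall A, measurable A -> nu A = mu (D `&` f @^-1` A)) /\
    forall (h : Y -> R) (M : R), measurable_fun setT h ->
      (forall y, `|h y| <= M) ->
      \int[nu]_y h y = \int[mu]_(t in D) h (f t).
Proof.
move=> mD muD mf.
have mg : measurable_fun setT (f \_ D) by exact: (measurable_restrictT f mD).1 mf.
pose m := mfrestr mD muD.
pose nu0 : {measure set Y -> \bar R} :=
  measure_function_pushforward__canonical__measure_function_Measure m mg.
have nu0fin : fin_num_fun nu0.
  move=> A mA; rewrite /nu0 /= /pushforward; apply: (@fin_num_measure _ _ _ m).
  by rewrite -[X in measurable X]setTI; exact: (mg measurableT _ mA).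
pose nu : {finite_measure set Y -> \bar R} :=
  HB.pack (Measure.sort nu0) (Measure_isFinite.Build _ _ _ nu0 nu0fin).
exists nu; split.
  move=> A mA; rewrite /nu /= /nu0 /pushforward /m /mfrestr /mrestr setIC.
  congr (mu _); apply/seteqP; split=> t /= [Dt]; rewrite patchE mem_set//.
move=> h M mh hM.
have mhf : measurable_fun D (h \o f) by exact: measurableT_comp.
have im : m.-integrable setT (EFin \o (h \o (f \_ D))).
  apply: (@integrable_bounded _ _ _ _ _ M) => [//||t _]; last exact: hM.
  exact: (measurableT_comp mh mg).
rewrite /Rintegral; congr fine.
rewrite (@integral_pushforward _ _ _ _ _ _ mg m setT (EFin \o h))//; last first.
  exact/measurable_EFinP.
rewrite (@negligible_integral _ _ _ m setT (~` D))//; last 2 first.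
- exact: measurableC.
- by rewrite /m /= /mfrestr /mrestr setICl measure0.
rewrite setTD setCK (eq_measure_integral mu).
  by apply: eq_integral => t tD; rewrite /= patchE tD.
by move=> A mA AD; rewrite /= /m /mfrestr /mrestr setIidl.
Qed.

End laws.

(** * Conditional probabilities from conditional cell weights *)

Section weights_kernel.
Context {R : realType} (K : ptopologicalType).
Hypotheses (cK : compact [set: K]) (mK : @metrizable R K).
Variable b : nat -> set K.
Hypothesis mb : mesh [set: K] b.

Lemma weights_probability (a : seq bool -> R) : tree_mass a -> a [::] = 1 ->
  (forall v, 0 < a v -> exists2 y, [set: K] y & word (bits b y) (size v) = v) ->
  exists P : probability (borel K) R, forall F : K -> R, continuous F ->
    forall J (e : R), osc_le setT b F J e ->
    `|\int[P]_s F s - \sum_(v : J.-tuple bool) F (cell_point setT b v) * a v| <= e.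
Proof.
move=> am a1 ab; have [chi [_ chiF]] := tree_law cK mb am ab.
set D := `[0, a [::][%classic in chiF.
have mD : measurable (D : set (measurableTypeR R)) by exact: measurable_itv.
have D1 : lebesgue_measure D = 1%E.
  rewrite /D a1; apply: etrans (lebesgue_measure_itv _) _.
  by rewrite /= lte_fin ltr01 -EFinB subr0.
have Dy : (lebesgue_measure D < +oo)%E by rewrite D1 ltry.
have mchi : measurable_fun D (chi : _ -> borel K).
  apply: (@measurable_fun_borel R) => // F cF.
  by have [] := chiF F (continuous_subspaceT cF).
have [nu [nuE nuI]] := restricted_law mD Dy mchi.
have nu1 : nu setT = 1%E by rewrite nuE// preimage_setT setIT.
pose P : probability (borel K) R := HB.pack (Measure.sort nu)
  (Measure_isProbability.Build _ _ _ nu nu1).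
exists P => F cF J e o.
have cF' : {within setT, continuous F} by exact: continuous_subspaceT.
have [M MF] := bounded_within cK cF'.
have := (chiF F cF').2 J e o; rewrite a1 mulr1.
rewrite -(nuI F M) //; first exact: continuous_borel_fun.
by move=> y; exact: MF.
Qed.

(** The probabilities are chosen point by point; measurability in [x] is
nevertheless automatic, as integrals of continuous functions are limits of
finite sums of measurable weights. *)
Lemma weights_kernel d (X : measurableType d) (a : X -> seq bool -> R) :
  (forall x, tree_mass (a x)) -> (forall x, a x [::] = 1) ->
  (forall v, measurable_fun setT (a ^~ v)) ->
  (forall x v, 0 < a x v ->
    exists2 y, [set: K] y & word (bits b y) (size v) = v) ->
  exists kappa : X -> probability (borel K) R, forall F : K -> R, continuous F ->
    measurable_fun setT (fun x => \int[kappa x]_s F s) /\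
    forall J (e : R), osc_le setT b F J e -> forall x,
    `|\int[kappa x]_s F s - \sum_(v : J.-tuple bool) F (cell_point setT b v) * a x v|
      <= e.
Proof.
move=> am a1 ma ab.
have /choice[kappa kP] x := weights_probability (am x) (a1 x) (ab x).
exists kappa => F cF; split; last by move=> J e o x; exact: kP.
have cF' : {within setT, continuous F} by exact: continuous_subspaceT.
have /choice[J JP] k : exists J, osc_le setT b F J k.+1%:R^-1.
  by apply: mesh_osc_le => //; rewrite invr_gt0.
apply: (@measurable_fun_cvg _ _ _ setT (fun k x =>
    \sum_(v : (J k).-tuple bool) F (cell_point setT b v) * a x v)) => [k|x _].
  by apply: measurable_sum => v; apply: measurable_funM => //; exact: ma.
apply/cvgrPdist_lt => e e0; near=> k.
apply: le_lt_trans (kP x F cF _ _ (JP k)) _.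
by near: k; exact: near_infty_natSinv_lt (PosNum e0).
Unshelve. all: by end_near. Qed.

End weights_kernel.

Section conditional_weights.
Context {R : realType}.

(** A Radon-Nikodym density with real values, nonnegative everywhere. *)
Lemma finite_density d (X : measurableType d)
    (nu sigma : {finite_measure set X -> \bar R}) :
  (forall A, measurable A -> sigma A = 0%E -> nu A = 0%E) ->
  exists rho : X -> R, [/\ forall x, 0 <= rho x, measurable_fun setT rho,
    sigma.-integrable setT (EFin \o rho) &
    forall A, measurable A -> \int[sigma]_(x in A) rho x = fine (nu A)].
Proof.
move=> /null_content_dominatesP nusigma.
pose f := Radon_Nikodym_SigmaFinite.f nu sigma.
have fE x : (fine (f x))%:E = f x.
  by rewrite fineK//; exact: Radon_Nikodym_SigmaFinite.f_fin_num.
have fi : sigma.-integrable setT (EFin \o (fine \o f)).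
  rewrite (_ : _ \o _ = f); last exact/funext.
  exact: Radon_Nikodym_SigmaFinite.f_integrable.
exists (fine \o f); split=> //.
- by move=> x; rewrite fine_ge0//; exact: Radon_Nikodym_SigmaFinite.f_ge0.
- by apply/measurable_EFinP; exact: measurable_int fi.
- move=> A mA; rewrite /Rintegral; congr fine.
  rewrite (@Radon_Nikodym_SigmaFinite.f_integral _ _ _ nu sigma)//.
  by apply: eq_integral => x _ /=; rewrite fE.
Qed.

Lemma Rintegral_ae_eq d (X : measurableType d)
    (sigma : {finite_measure set X -> \bar R}) (f g : X -> R) :
  sigma.-integrable setT (EFin \o f) -> sigma.-integrable setT (EFin \o g) ->
  (forall A, measurable A ->
    \int[sigma]_(x in A) f x = \int[sigma]_(x in A) g x) ->
  {ae sigma, forall x, f x = g x}.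
Proof.
move=> fi gi fg.
have := @integral_ae_eq _ _ _ sigma setT measurableT _ _ fi (measurable_int _ gi).
have h : forall A, A `<=` setT -> measurable A ->
    (\int[sigma]_(x in A) (EFin \o f) x = \int[sigma]_(x in A) (EFin \o g) x)%E.
  move=> A _ mA; rewrite -(EFin_Rintegral mA) -?(EFin_Rintegral mA) ?fg//.
    exact: integrableS gi.
  exact: integrableS fi.
by move=> /(_ h); apply: filterS => x /(_ I) [].
Qed.

Variables (d : _) (X : measurableType d) (K : ptopologicalType).
Variable b : nat -> set K.
Hypothesis ob : forall j, open (b j).
Variables (Lam : {finite_measure set (X * borel K)%type -> \bar R})
  (sigma : {finite_measure set X -> \bar R}).
Hypothesis sigmaE : forall A, measurable A -> sigma A = Lam (A `*` [set: borel K]).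

Local Notation c := (fun t : (X * borel K)%type => bits b t.2).
Local Notation D A := (A `*` [set: borel K] : set (X * borel K)%type).
Local Notation mass A v := (\int[Lam]_(t in cell (D A) c v) (1 : R)).

Lemma measurable_cylinder (A : set X) : measurable A -> measurable (D A).
Proof. by move=> mA; exact: measurableX. Qed.

Lemma measurable_bits_snd (A : set X) : measurable A ->
  forall j, measurable (D A `&` [set t | c t j]).
Proof.
move=> mA j; rewrite (_ : _ `&` _ = A `*` (b j : set (borel K))).
  by apply: measurableX => //; exact: sub_sigma_algebra.
apply/seteqP; rewrite /bits; split=> t /=.
  by move=> [[At _] /asboolP].
by move=> [At tj]; split=> //; exact/asboolP.
Qed.

Lemma cylinder_massE (A : set X) v : measurable A ->
  mass A v = fine (Lam (cell (D A) c v)).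
Proof.
move=> mA; rewrite Rintegral_cst ?mul1r//.
exact: (measurable_cell (measurable_cylinder mA) (measurable_bits_snd mA)).
Qed.

Lemma integrable_cylinder1 (A : set X) : measurable A ->
  Lam.-integrable (D A) (EFin \o cst (1 : R)).
Proof.
move=> mA; apply: (@integrable_bounded _ _ _ _ _ _ 1) => [|//|t _].
  exact: measurable_cylinder.
by rewrite /= normr1.
Qed.

Lemma tree_mass_cylinder (A : set X) : measurable A ->
  tree_mass (fun v => mass A v).
Proof.
move=> mA; apply: (tree_mass_cell (measurable_cylinder mA) (measurable_bits_snd mA)) => //.
exact: integrable_cylinder1.
Qed.

(** The conditional weight of [v] is the density of A |-> Lam (A x cell of v) with
respect to [sigma].  Additivity, normalization and vanishing on empty cells hold
almost everywhere for each word, hence off one null set for all the words at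
once. *)
Lemma conditional_weights :
  exists a : X -> seq bool -> R,
  [/\ forall x, tree_mass (a x), forall x, a x [::] = 1,
    forall v, measurable_fun setT (a ^~ v),
    forall x v, 0 < a x v ->
      exists2 y, [set: K] y & word (bits b y) (size v) = v &
    forall A v, measurable A -> \int[sigma]_(x in A) a x v = mass A v].
Proof.
have mT : measurable [set: X] by [].
have /choice[rho rhoP] v : exists rho : X -> R, [/\ forall x, 0 <= rho x,
    measurable_fun setT rho, sigma.-integrable setT (EFin \o rho) &
    forall A, measurable A -> \int[sigma]_(x in A) rho x = mass A v].
  have mB : measurable (cell (D setT) c v).
    exact: (measurable_cell (measurable_cylinder mT) (measurable_bits_snd mT)).
  have By : (Lam (cell (D setT) c v) < +oo)%E by rewrite ltey_eq fin_num_measure.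
  have [nu [nuE _]] := restricted_law mB By (measurable_funTS measurable_fst).
  have [|rho [? ? ? rhoE]] := @finite_density _ _ nu sigma.
    move=> A mA A0; rewrite nuE//; apply: (@subset_measure0 _ _ _ _ _ (D A)).
    - apply: measurableI => //; rewrite -[X in measurable X]setTI.
      exact: measurable_fst.
    - exact: measurable_cylinder.
    - by move=> t [].
    - exact: etrans (esym (sigmaE mA)) A0.
  exists rho; split=> // A mA; rewrite rhoE// cylinder_massE// nuE//; congr (fine (Lam _)).
  by apply/seteqP; split=> t /=; [move=> [[_ ?] ?]|move=> [[]]].
pose empty v := forall t, cell (D setT) c v t -> False.
pose good v x := [/\ rho v x = rho (rcons v false) x + rho (rcons v true) x,
  empty v -> rho v x = 0 & v = [::] -> rho v x = 1].
have ae_good : {ae sigma, forall x, forall v, good v x}.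
  (* null sets are united along an enumeration of the words *)
  pose P (n : nat) x := if unpickle n is Some v then good v x else True.
  have : {ae sigma, forall x, forall n, P n x}.
    apply: ae_foralln => n; rewrite /P.
    case: (unpickle n) => [v|]; last exact: aeW.
    have ae1 : {ae sigma, forall x,
        rho v x = rho (rcons v false) x + rho (rcons v true) x}.
      have [_ _ iv vE] := rhoP v.
      have [_ _ i0 E0] := rhoP (rcons v false).
      have [_ _ i1' E1] := rhoP (rcons v true).
      apply: Rintegral_ae_eq => // [|A mA].
        exact: (integrableD measurableT i0 i1').
      rewrite RintegralD//; [|exact: integrableS i0|exact: integrableS i1'].
      by rewrite vE// E0// E1// (tree_mass_cylinder mA).2.
    have ae2 : {ae sigma, forall x, empty v -> rho v x = 0}.
      have [ev|nev] := pselect (empty v); last by apply: aeW => x /nev.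
      have [_ _ iv vE] := rhoP v.
      have : {ae sigma, forall x, rho v x = cst 0 x}.
        apply: Rintegral_ae_eq => // [|A mA]; first exact: integrable0.
        rewrite Rintegral_cst// mul0r vE//.
        rewrite (_ : cell _ _ _ = set0) ?Rintegral_set0//.
        apply/seteqP; split=> t // [[At _] tv]; apply: (ev t).
        by split.
      by apply: filterS => x.
    have ae3 : {ae sigma, forall x, v = [::] -> rho v x = 1}.
      have [v0|nv] := pselect (v = [::]); last by apply: aeW => x /nv.
      have [_ _ iv vE] := rhoP v.
      have : {ae sigma, forall x, rho v x = cst 1 x}.
        apply: Rintegral_ae_eq => // [|A mA].
          by apply: (@integrable_bounded _ _ _ _ _ _ 1) => // x _ /=; rewrite normr1.
        rewrite Rintegral_cst// mul1r vE// cylinder_massE//; congr fine.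
        apply: esym; apply: etrans (sigmaE mA) _; congr (Lam _).
        by rewrite v0; apply/seteqP; split=> t; [split|case].
      by apply: filterS => x.
    by apply: filterS3 ae1 ae2 ae3 => x; split.
  apply: filterS => x h v; have := h (pickle v); by rewrite /P pickleK.
have [N [mN N0 Ngood]] := ae_good.
have goodP x : ~ N x -> forall v, good v x.
  by move=> nN; apply: contrapT => ng; apply/nN/Ngood.
(* on the exceptional null set, the densities are replaced by the weights of the
   point mass at [point] *)
pose dirac_word v : R := (v == word (bits b point) (size v))%:R.
pose a x v := if x \in N then dirac_word v else rho v x.
have rho0 v x : 0 <= rho v x by have [] := rhoP v.
have aN x : N x -> a x = dirac_word by move=> xN; rewrite /a mem_set.
have anN x : ~ N x -> a x = rho ^~ x by move=> xN; rewrite /a memNset.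
have ma v : measurable_fun setT (a ^~ v).
  apply: measurable_fun_ifT => //; last by have [] := rhoP v.
  apply: (@measurable_fun_bool _ _ setT _ true).
  rewrite setTI (_ : _ @^-1` _ = N)//.
  by apply/seteqP; split=> x /=; [move=> /set_mem|move=> /mem_set].
exists a; split.
- move=> x; have [xN|xN] := pselect (N x); last first.
    by rewrite anN//; split=> v; [exact: rho0|have [] := goodP x xN v].
  rewrite aN//; split=> v; first by rewrite /dirac_word ler0n.
  rewrite /dirac_word !size_rcons /word mkseqS !eqseq_rcons.
  by case: (v == _); case: (bits _ _ _); rewrite /= ?addr0 ?add0r.
- move=> x; have [xN|xN] := pselect (N x); first by rewrite aN// /dirac_word eqxx.
  by rewrite anN//; have [_ _] := goodP x xN [::]; apply.
- exact: ma.
- move=> x v; have [xN|xN] := pselect (N x).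
    rewrite aN// /dirac_word; case: eqP => // [vE _|]; last by rewrite ltxx.
    by exists point.
  rewrite anN// => r0; apply: contrapT => nex; have [_ + _] := goodP x xN v.
  have ev : empty v.
    by move=> t [_ tv]; apply: nex; exists t.2.
  by move=> /(_ ev) rv; rewrite rv ltxx in r0.
- move=> A v mA; have [_ mr ir <-//] := rhoP v.
  rewrite /Rintegral; congr fine; apply: ae_eq_integral => //.
  + by apply/measurable_EFinP; exact: measurable_funTS.
  + apply/measurable_EFinP; exact: measurable_funTS.
  + exists N; split=> // x /= nx; apply: contrapT => nN; apply: nx => _.
    by rewrite anN.
Qed.

End conditional_weights.

(** * Disintegration *)

Section disintegration.
Context {R : realType} d (X : measurableType d) (K : ptopologicalType).
Hypotheses (cK : compact [set: K]) (mK : @metrizable R K).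
Variables (Lam : {finite_measure set (X * borel K)%type -> \bar R})
  (sigma : {finite_measure set X -> \bar R}).
Hypothesis sigmaE : forall A, measurable A -> sigma A = Lam (A `*` [set: borel K]).

Local Notation D A := (A `*` [set: borel K] : set (X * borel K)%type).

(** The integral of [F] against [Lam] and that against [kappa] have the same cell
sums, whose errors are bounded by the oscillation of [F] over the cells. *)
Lemma disintegration_continuous :
  exists kappa : X -> probability (borel K) R,
  forall F : K -> R, continuous F ->
    measurable_fun setT (fun x => \int[kappa x]_s F s) /\
    forall A, measurable A ->
      \int[Lam]_(t in D A) F t.2 = \int[sigma]_(x in A) \int[kappa x]_s F s.
Proof.
have [b [ob mb]] := metrizable_mesh mK cK.
have [a [am a1 ma ab aE]] := conditional_weights ob sigmaE.
have [kappa kP] := weights_kernel cK mK mb am a1 ma ab.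
exists kappa => F cF; have [mkF kF] := kP F cF; split=> // A mA.
have cF' : {within setT, continuous F} by exact: continuous_subspaceT.
have [M MF] := bounded_within cK cF'.
have kM x : `|\int[kappa x]_s F s| <= M.
  apply: norm_Rintegral_probability; first exact: continuous_borel_fun.
  by move=> y; exact: MF.
apply/eqP; rewrite -subr_eq0 -normr_le0; apply/ler_addgt0Pr => r r0; rewrite add0r.
pose m := fine (sigma A).
have m0 : 0 <= m by rewrite fine_ge0.
pose e := r / 2 / (m + 1).
have e0 : 0 < e by rewrite !divr_gt0// ltr_pwDr.
have em : e * m <= r / 2.
  rewrite /e -mulrA ger_pMr ?divr_gt0// mulrC ler_pdivrMr ?ltr_pwDr// mul1r.
  by rewrite lerDl.
have [J o] := mesh_osc_le cK mb cF' e0.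
pose mass v := \int[Lam]_(t in cell (D A) (fun t => bits b t.2) v) (1 : R).
have i1 : Lam.-integrable (D A) (EFin \o cst (1 : R)) by exact: integrable_cylinder1.
have h1 : `|\int[Lam]_(t in D A) F t.2 -
    \sum_(v : J.-tuple bool) F (cell_point setT b v) * mass v| <= r / 2.
  have zc t : D A t -> @decodes R K setT b t.2 (bits b t.2).
    by move=> _; exact: decodes_bits.
  have := sample_sum cK mb (measurable_cylinder mA) (measurable_bits_snd ob mA)
    zc cF' o (fun _ _ => ler01) i1.
  rewrite Rintegral_cst ?mul1r//; last exact: measurable_cylinder.
  rewrite (_ : fine (Lam _) = m); last first.
    by rewrite /m sigmaE.
  move=> h; apply: le_trans em; apply: le_trans h.
  rewrite le_eqVlt; apply/orP; left; apply/eqP; congr (`|_ - _|).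
  by apply: eq_Rintegral => t _; rewrite mulr1.
have ia v : sigma.-integrable A (EFin \o (a ^~ v)).
  apply: (@integrable_bounded _ _ _ _ _ _ 1) => // [|x _].
    by apply: measurable_funTS; exact: ma.
  by rewrite ger0_norm ?(am x).1// -(a1 x); exact: tree_mass_le.
pose s x := \sum_(v : J.-tuple bool) F (cell_point setT b v) * a x v.
have is_ (v : J.-tuple bool) :
    sigma.-integrable A (EFin \o (fun x => F (cell_point setT b v) * a x v)).
  exact: (integrableZl mA _ (ia v)).
have sE : \int[sigma]_(x in A) s x =
    \sum_(v : J.-tuple bool) F (cell_point setT b v) * mass v.
  rewrite Rintegral_sum//; apply: eq_bigr => v _.
  by rewrite RintegralZl//; congr (_ * _); exact: aE.
have iss : sigma.-integrable A (EFin \o s).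
  rewrite (_ : _ \o _ = (fun x => \sum_(v : J.-tuple bool)
    (F (cell_point setT b v) * a x v)%:E)%E); last first.
    by apply/funext => x; rewrite /= sumEFin.
  apply: (@integrable_sum _ _ _ sigma A mA _ _ xpredT
    (fun (v : J.-tuple bool) x => (F (cell_point setT b v) * a x v)%:E)) => v _; exact: is_.
have ik : sigma.-integrable A (EFin \o (fun x => \int[kappa x]_s F s)).
  apply: (@integrable_bounded _ _ _ _ _ _ M) => //.
  exact: measurable_funTS.
have h2 : `|\int[sigma]_(x in A) (\int[kappa x]_s F s) - \int[sigma]_(x in A) s x|
    <= r / 2.
  rewrite -RintegralB//.
  apply: le_trans (le_normr_Rintegral mA (integrableB mA ik iss)) _.
  have ie : sigma.-integrable A (EFin \o cst e).
    by apply: (@integrable_bounded _ _ _ _ _ _ `|e|).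
  apply: le_trans (le_Rintegral mA (integrable_norm (integrableB mA ik iss)) ie _) _.
    by move=> x _; exact: kF.
  by rewrite Rintegral_cst.
rewrite sE in h2; move: h1 h2; rewrite !ler_norml.
move=> /andP[? ?] /andP[? ?]; apply/andP; split; lra.
Qed.

End disintegration.

Section borel_upgrade.
Context {R : realType} (K : ptopologicalType).
Hypothesis mK : @metrizable R K.

(** The truncations of [n * D], where [D] vanishes exactly outside [O]. *)
Lemma open_indicator_approx (O : set K) : open O ->
  exists F : nat -> K -> R, [/\ forall n, continuous (F n),
    forall n x, 0 <= F n x <= 1,
    forall x n m, (n <= m)%N -> F n x <= F m x &
    forall x, F n x @[n --> \oo] --> (\1_O x : R)].
Proof.
move=> oO; have [D [cD D0 DO]] := metrizable_cozero mK oO.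
exists (fun n x => Num.min 1 (n%:R * D x)); split.
- move=> n x; apply: (@continuous_min R K (cst 1) (fun x => n%:R * D x)).
    exact: cvg_cst.
  by apply: cvgM; [exact: cvg_cst|exact: cD].
- by move=> n x; rewrite ge_min lexx le_min ler01 mulr_ge0.
- move=> x n m nm; rewrite le_min !ge_min lexx /= ler_wpM2r ?orbT//.
  by rewrite ler_nat.
- move=> x; rewrite indicE; have [Ox|nOx] := pselect (O x).
    rewrite mem_set//; apply: cvg_near_cst; near=> n.
    apply/min_idPl; rewrite -ler_pdivrMr; last exact/DO.
    by near: n; exact: nbhs_infty_ger.
  rewrite memNset//; have -> : D x = 0.
    by apply/eqP; rewrite eq_le D0 andbT leNgt; apply/negP => /DO.
  by apply: cvg_near_cst; apply: nearW => n; rewrite mulr0 min_r.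
Unshelve. all: by end_near. Qed.

Lemma cvg_open_indicator d (T : measurableType d)
    (m : {measure set T -> \bar R}) (D : set T) (eta : T -> borel K)
    (O : set K) (F : nat -> K -> R) :
  measurable D -> measurable_fun setT eta -> open O ->
  (forall n, continuous (F n)) -> (forall n x, 0 <= F n x <= 1) ->
  (forall x n m, (n <= m)%N -> F n x <= F m x) ->
  (forall x, F n x @[n --> \oo] --> (\1_O x : R)) ->
  (\int[m]_(t in D) (F n (eta t))%:E)%E @[n --> \oo] --> m (D `&` eta @^-1` O).
Proof.
move=> mD meta oO cF F01 Fnd Fcvg.
have mF n : measurable_fun D (fun t => (F n (eta t))%:E).
  apply/measurable_EFinP; apply: (@measurableT_comp _ _ _ _ (borel K) _ (F n)).
    exact: continuous_borel_fun.
  exact: measurable_funTS.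
have mO : measurable (eta @^-1` O).
  rewrite -[X in measurable X]setTI; apply: meta => //.
  exact: sub_sigma_algebra.
have := @cvg_monotone_convergence _ _ _ m D mD _ mF.
rewrite (eq_integral (EFin \o \1_(eta @^-1` O))); last first.
  move=> t _; apply/cvg_lim => //; apply/cvg_EFin; first exact: nearW.
  rewrite /=; apply: Fcvg.
rewrite integral_indic// setIC; apply.
- by move=> n t _; rewrite lee_fin; case/andP: (F01 n (eta t)).
- by move=> t _ n k nk; rewrite lee_fin; exact: Fnd.
Qed.

End borel_upgrade.

Section disintegration_sets.
Context {R : realType} d (X : measurableType d) (K : ptopologicalType).
Hypothesis mK : @metrizable R K.
Variables (Lam : {finite_measure set (X * borel K)%type -> \bar R})
  (sigma : {finite_measure set X -> \bar R}).
Variable kappa : X -> probability (borel K) R.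

Local Notation D A := (A `*` [set: borel K] : set (X * borel K)%type).

Hypothesis kappaP : forall F : K -> R, continuous F ->
    measurable_fun setT (fun x => \int[kappa x]_s F s) /\
    forall A, measurable A ->
      \int[Lam]_(t in D A) F t.2 = \int[sigma]_(x in A) \int[kappa x]_s F s.

(** The identity for one Borel set, together with the measurability that gives a
meaning to its right-hand side: both are carried through the induction. *)
Let disint (B : set (borel K)) := measurable_fun setT (fun x => kappa x B) /\
  forall A, measurable A ->
    Lam (A `*` B) = (\int[sigma]_(x in A) kappa x B)%E.

Let disint_open (O : set K) : open O -> disint O.
Proof.
move=> oO; have [F [cF F01 Fnd Fcvg]] := open_indicator_approx mK oO.
have Fb n x : `|F n x| <= 1 by have /andP[? ?] := F01 n x; rewrite ger0_norm.
have mF n : measurable_fun [set: borel K] (F n) by exact: continuous_borel_fun.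
pose I n x : \bar R := (\int[kappa x]_s (F n s)%:E)%E.
have IE n x : I n x = (\int[kappa x]_s F n s)%:E.
  rewrite EFin_Rintegral//; apply: (@integrable_bounded _ _ _ _ _ _ 1) => //.
have mI n : measurable_fun setT (I n).
  rewrite (_ : I n = EFin \o (fun x => \int[kappa x]_s F n s)); last exact/funext.
  by apply/measurable_EFinP; have [] := kappaP (cF n).
have Icvg x : I n x @[n --> \oo] --> kappa x O.
  have := @cvg_open_indicator _ K _ (borel K) (kappa x) setT id O F measurableT
    (@measurable_id _ _ _) oO cF F01 Fnd Fcvg.
  by rewrite setTI.
split.
  by apply: (emeasurable_fun_cvg I) => // x _; exact: Icvg.
move=> A mA.
have lhs := @cvg_open_indicator _ K _ _ Lam (D A) snd O F
  (measurable_cylinder mA) measurable_snd oO cF F01 Fnd Fcvg.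
rewrite (_ : _ `&` _ = A `*` (O : set (borel K))) in lhs; last first.
  by apply/seteqP; split=> t /=; [move=> [[? _] ?]|move=> [? ?]].
have rhs : (\int[sigma]_(x in A) I n x)%E @[n --> \oo] -->
    (\int[sigma]_(x in A) kappa x O)%E.
  have := @cvg_monotone_convergence _ _ _ sigma A mA I.
  rewrite (eq_integral (fun x => kappa x O)); last first.
    by move=> x _; apply/cvg_lim => //; exact: Icvg.
  apply.
  - by move=> n; exact: measurable_funTS.
  - move=> n x _; apply: integral_ge0 => s _; rewrite lee_fin.
    by case/andP: (F01 n s).
  - move=> x _ n k nk; rewrite !IE lee_fin; apply: le_Rintegral => //.
    + by apply: (@integrable_bounded _ _ _ _ _ _ 1).
    + by apply: (@integrable_bounded _ _ _ _ _ _ 1).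
    + by move=> s _; exact: Fnd.
move: lhs; rewrite (_ : (fun n => _) = (fun n => \int[sigma]_(x in A) I n x)%E).
  by move=> lhs; apply: (cvg_unique (@ereal_hausdorff R) lhs rhs).
apply/funext => n; under [RHS]eq_integral do rewrite IE.
rewrite -EFin_Rintegral; [|exact: measurable_cylinder|]; last first.
  apply: (@integrable_bounded _ _ _ _ _ _ 1) => //; first exact: measurable_cylinder.
  by apply: measurable_funTS; exact: measurableT_comp (mF n) measurable_snd.
rewrite (kappaP (cF n)).2// EFin_Rintegral//.
apply: (@integrable_bounded _ _ _ _ _ _ 1) => //.
  by apply: measurable_funTS; have [] := kappaP (cF n).
by move=> x _; exact: norm_Rintegral_probability.
Qed.

(** Open sets are stable under intersection and generate the Borel sets; monotone
convergence gives the identity for them, and the sets satisfying it form a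
lambda-system.  Complements use that [Lam] is finite and that each [kappa x] is a
probability. *)
Lemma disintegration_sets (B : set (borel K)) : measurable B ->
  measurable_fun setT (fun x => kappa x B) /\
  forall A, measurable A ->
    Lam (A `*` B) = (\int[sigma]_(x in A) kappa x B)%E.
Proof.
move=> mB; have [LB] : measurable B /\ disint B; last by [].
split=> //; move: B mB.
apply: (@dynkin_induction _ (borel K) (open : set (set K)) disint) => //.
- exact: openI.
- exact: (disint_open (@openT K)).
- move=> B mB [kB LB].
  have mCB : measurable_fun setT (fun x => kappa x (~` B)).
    rewrite (_ : (fun x => _) = (fun x => 1 - kappa x B)%E); last first.
      by apply/funext => x; rewrite probability_setC.
    exact: emeasurable_funB.
  split=> //.
  move=> A mA; have [_ LT] := disint_open (@openT K).
  have ABfin : Lam (A `*` B) \is a fin_num by apply: fin_num_measure; exact: measurableX.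
  rewrite -[LHS](addeK _ ABfin) -[RHS](addeK _ ABfin); congr (_ - _)%E.
  rewrite -measureU//; last 3 first.
  + by apply: measurableX => //; exact: measurableC.
  + exact: measurableX.
  + by apply/seteqP; split=> // t [[_ nBt] [_ Bt]]; exact: nBt.
  rewrite (_ : _ `|` _ = A `*` [set: borel K]); last first.
    apply/seteqP; split=> t; first by move=> [] [].
    by move=> [At _]; have [|] := pselect (B t.2); [right|left].
  apply: etrans (LT A mA) _; rewrite LB// -ge0_integralD//; [|exact: measurable_funTS..].
  apply: eq_integral => x _; rewrite -measureU ?setUCl//; last by rewrite setICl.
  exact: measurableC.
- move=> F mF tF LF; split.
    rewrite (_ : (fun x => _) = (fun x => \sum_(i <oo) kappa x (F i))%E); last first.
      apply/funext => x; rewrite measure_semi_bigcup//; exact: bigcupT_measurable.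
    apply: ge0_emeasurable_sum => // n _; exact: (LF n).1.
  move=> A mA; rewrite setX_bigcupr measure_semi_bigcup//; last 3 first.
  + by move=> i; exact: measurableX.
  + apply/trivIsetP => i j _ _ ij; apply/seteqP; split=> // t [[_ ti] [_ tj]].
    have /trivIsetP /(_ i j I I ij) FF0 := tF.
    have : (F i `&` F j) t.2 by split.
    by rewrite FF0.
  + by apply: bigcupT_measurable => i; exact: measurableX.
  under eq_integral.
    move=> x _; rewrite measure_semi_bigcup//; last exact: bigcupT_measurable.
    over.
  rewrite integral_nneseries//; last by move=> n; apply: measurable_funTS; exact: (LF n).1.
  by apply: eq_eseriesr => i _; exact: (LF i).2.
Qed.

End disintegration_sets.

Section disintegration.
Context {R : realType} d (X : measurableType d) (K : ptopologicalType).

Section joint_integral.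
Variables (Lam : {finite_measure set (X * borel K)%type -> \bar R})
  (sigma : {finite_measure set X -> \bar R}).
Variable kappa : X -> probability (borel K) R.
Hypothesis mkappa : forall B : set (borel K), measurable B ->
  measurable_fun setT (fun x => kappa x B).
Hypothesis LamE : forall (A : set X) (B : set (borel K)),
  measurable A -> measurable B ->
  Lam (A `*` B) = (\int[sigma]_(x in A) kappa x B)%E.

Let kap (x : X) : {measure set (borel K) -> \bar R} := kappa x.
Let kap1 x : kap x setT = 1%E. Proof. exact: probability_setT. Qed.
Let kapm : R.-ker X ~> borel K := HB.pack kap
  (isKernel.Build _ _ X (borel K) R kap mkappa).
Let kapk : R.-pker X ~> borel K := HB.pack (Kernel.sort kapm)
  (Kernel_isProbability.Build _ _ X (borel K) R kapm kap1).

(** [Lam] is recovered as a composition of kernels: a one-point space is sent to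
[sigma], and then [x] to the law of [(x, s)] with [s] distributed as [kappa x].
Integration against a composition is then the integration formula sought. *)
Let fib (ux : (unit * X)%type) : {measure set (X * borel K)%type -> \bar R} :=
  measure_function_pushforward__canonical__measure_function_Measure
    (kap ux.2) (pair1_measurable ux.2).
Let fibE ux U : fib ux U = kap ux.2 (xsection U ux.2).
Proof. by rewrite xsectionE. Qed.
Let mfib U : measurable U -> measurable_fun setT (fib ^~ U).
Proof.
move=> mU; rewrite (_ : fib ^~ U = (fun x => kapk x (xsection U x)) \o snd).
  apply: measurableT_comp => //; apply: measurable_fun_xsection_finite_kernel.
  exact/mem_set.
by apply/funext => ux; rewrite fibE.
Qed.
Let fib1 ux : fib ux setT = 1%E.
Proof. by rewrite fibE xsectionE preimage_setT kap1. Qed.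
Let fibm : R.-ker (unit * X)%type ~> (X * borel K)%type := HB.pack fib
  (isKernel.Build _ _ (unit * X)%type (X * borel K)%type R fib mfib).
Let fibk : R.-pker (unit * X)%type ~> (X * borel K)%type :=
  HB.pack (Kernel.sort fibm) (Kernel_isProbability.Build _ _ (unit * X)%type
    (X * borel K)%type R fibm fib1).

Let base (u : unit) : {measure set X -> \bar R} := sigma.
Let mbase U : measurable U -> measurable_fun setT (base ^~ U).
Proof. by move=> _; exact: measurable_cst. Qed.
Let base_uub : measure_fam_uub base.
Proof.
exists (fine (sigma setT) + 1) => u; rewrite /base -[ltLHS]fineK ?fin_num_measure//.
by rewrite lte_fin ltrDl.
Qed.
Let basem : R.-ker unit ~> X := HB.pack base
  (isKernel.Build _ _ unit X R base mbase).
Let basek : R.-fker unit ~> X := HB.pack (Kernel.sort basem)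
  (Kernel_isFinite.Build _ _ unit X R basem base_uub).

(** Two finite measures that agree on rectangles are equal. *)
Let joint_lawE (E : set (X * borel K)%type) : measurable E ->
  Lam E = kcomp basek fibk tt E.
Proof.
move=> mE.
pose G : set (set (X * borel K)%type) := [set A `*` B | A in measurable & B in measurable].
apply: (@measure_unique _ R _ G (fun=> setT) _ _ _ _ Lam
  (mkcomp basek fibk tt)) => //.
- exact: measurable_prod_measurableType.
- move=> _ _ [A1 mA1 [B1 mB1 <-]] [A2 mA2 [B2 mB2 <-]].
  exists (A1 `&` A2); first exact: measurableI.
  by exists (B1 `&` B2); [exact: measurableI|rewrite setXI].
- by move=> _; exists setT => //; exists setT => //; rewrite setXTT.
- by rewrite bigcup_const.
- move=> _ [A mA [B mB <-]]; apply: etrans (LamE mA mB) _.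
  rewrite integral_mkcond /= /kcomp.
  apply: eq_integral => x _; apply: etrans (esym (fibE (tt, x) _)).
  rewrite patchE /=; case: ifPn => xA; first by rewrite in_xsectionX.
  by rewrite notin_xsectionX// measure0.
- by move=> _; rewrite ltey_eq fin_num_measure.
Qed.

Lemma ge0_integral_disintegration (h : X * borel K -> \bar R) :
  measurable_fun setT h -> (forall t, 0 <= h t)%E ->
  (\int[Lam]_t h t = \int[sigma]_x \int[kappa x]_s h (x, s))%E.
Proof.
move=> mh h0.
transitivity (\int[kcomp basek fibk tt]_t h t)%E.
  by apply: eq_measure_integral => E mE _; exact: joint_lawE.
rewrite (integral_kcomp basek fibk tt h0 mh).
apply: eq_integral => x _.
by rewrite (ge0_integral_pushforward (pair1_measurable x)).
Qed.

Lemma measurable_disintegration (h : X * borel K -> \bar R) :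
  measurable_fun setT h -> (forall t, 0 <= h t)%E ->
  measurable_fun setT (fun x => \int[kappa x]_s h (x, s))%E.
Proof.
by move=> mh h0; exact: (measurable_fun_integral_finite_kernel h kapk h0 mh).
Qed.

(** Adding the bound [M] reduces to a nonnegative function. *)
Lemma Rintegral_disintegration (h : X * borel K -> R) (M : R) :
  measurable_fun setT h -> (forall t, `|h t| <= M) ->
  \int[Lam]_t h t = \int[sigma]_x \int[kappa x]_s h (x, s).
Proof.
move=> mh hM.
have mhx x : measurable_fun setT (fun s => h (x, s)).
  exact: measurableT_comp mh (pair1_measurable x).
have ih x : (kappa x).-integrable setT (EFin \o (fun s => h (x, s))).
  by apply: (@integrable_bounded _ _ _ _ _ _ M) => // s _; exact: hM.
have iM d' (T : measurableType d') (P : {finite_measure set T -> \bar R}) :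
    P.-integrable setT (EFin \o cst M).
  by apply: (@integrable_bounded _ _ _ _ _ _ `|M|).
have iLam : Lam.-integrable setT (EFin \o h).
  by apply: (@integrable_bounded _ _ _ _ _ _ M) => // t _; exact: hM.
pose g t := (h t + M)%:E.
have g0 t : (0 <= g t)%E.
  by rewrite lee_fin -lerBlDr sub0r; have := hM t; rewrite ler_norml => /andP[].
have mg : measurable_fun setT g.
  by apply/measurable_EFinP; exact: measurable_funD.
have gE x : (\int[kappa x]_s g (x, s))%E = (\int[kappa x]_s h (x, s) + M)%:E.
  rewrite -(@EFin_Rintegral _ _ _ _ _ (fun s => h (x, s) + M))//; last first.
    exact: integrableD (ih x) (iM _ _ (kappa x)).
  rewrite (RintegralD measurableT (ih x) (iM _ _ (kappa x))).
  by rewrite Rintegral_cst// [X in fine X]probability_setT mulr1.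
have mIM : measurable_fun setT (fun x => \int[kappa x]_s h (x, s) + M).
  have <- : fine \o (fun x => \int[kappa x]_s g (x, s))%E =
      (fun x => \int[kappa x]_s h (x, s) + M).
    by apply/funext => y; rewrite /= gE.
  by apply: measurableT_comp => //; exact: measurable_disintegration.
have mI : measurable_fun setT (fun x => \int[kappa x]_s h (x, s)).
  have -> : (fun x => \int[kappa x]_s h (x, s)) =
      (fun x => \int[kappa x]_s h (x, s) + M) \- cst M.
    by apply/funext => y; rewrite /= addrK.
  exact: measurable_funB.
have iI : sigma.-integrable setT (EFin \o (fun x => \int[kappa x]_s h (x, s))).
  apply: (@integrable_bounded _ _ _ _ _ _ M) => // x0 _.
  by apply: norm_Rintegral_probability => // s; exact: hM.
have := ge0_integral_disintegration mg g0.
rewrite -(@EFin_Rintegral _ _ _ _ _ (fun t => h t + M))//; last first.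
  exact: integrableD iLam (iM _ _ Lam).
under eq_integral do rewrite gE.
rewrite -(@EFin_Rintegral _ _ _ _ _ (fun x => \int[kappa x]_s h (x, s) + M))//.
  move=> [].
  rewrite (RintegralD measurableT iLam (iM _ _ Lam)).
  rewrite (RintegralD measurableT iI (iM _ _ sigma)).
  rewrite !Rintegral_cst//.
  rewrite (_ : fine (Lam _) = fine (sigma setT)); first exact: addIr.
  congr fine; rewrite -setXTT; apply: etrans (LamE measurableT measurableT) _.
  rewrite (eq_integral (cst 1%E)) ?integral_cst ?mul1e// => x _.
  exact: probability_setT.
exact: integrableD iI (iM _ _ sigma).
Qed.

End joint_integral.

Hypotheses (cK : compact [set: K]) (mK : @metrizable R K).

Lemma disintegration (Lam : {finite_measure set (X * borel K)%type -> \bar R})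
    (sigma : {finite_measure set X -> \bar R}) :
  (forall A, measurable A -> sigma A = Lam (A `*` [set: borel K])) ->
  exists kappa : X -> probability (borel K) R,
    (forall F : K -> R, continuous F ->
      measurable_fun setT (fun x => \int[kappa x]_s F s)) /\
    forall (h : X * borel K -> R) (M : R),
      measurable_fun setT h -> (forall t, `|h t| <= M) ->
      \int[Lam]_t h t = \int[sigma]_x \int[kappa x]_s h (x, s).
Proof.
move=> sigmaE.
have [kappa kP] := disintegration_continuous cK mK sigmaE.
exists kappa; split=> [F cF|h M]; first by have [] := kP F cF.
apply: Rintegral_disintegration => [B mB|A B mA mB].
  by have [] := disintegration_sets mK kP mB.
by have [_] := disintegration_sets mK kP mB; apply.
Qed.

End disintegration.

(** * The domain and the growth weight *)

Section domain.
Context {R : realType} {n : nat}.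
Implicit Type Om : set 'rV[R]_n.

Lemma metrizable_rV : @metrizable R 'rV[R]_n.
Proof.
exists (fun x y => `|x - y|); split.
- move=> x y; split=> [/normr0_eq0/subr0_eq//|->]; first by rewrite subrr normr0.
- by move=> x y; rewrite distrC.
- by move=> x y z; rewrite -(subrKA y) ler_normD.
- move=> x N; split=> [/nbhs_normP[e /= e0 eN]|[e e0 eN]]; first by exists e.
  by apply/nbhs_ballP; exists e => //; rewrite -ball_normE.
Qed.

Lemma bounded_set_norm Om : bounded_set Om ->
  exists2 M : R, 0 < M & forall x, Om x -> `|x| <= M.
Proof.
move=> [M [_ MO]]; exists (`|M| + 1); first by rewrite ltr_wpDl.
by apply: MO; rewrite (le_lt_trans (ler_norm M))// ltrDl.
Qed.

Lemma compact_closure_bounded Om : bounded_set Om -> compact (closure Om).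
Proof.
move=> bO; have [M M0 MO] := bounded_set_norm bO.
apply: bounded_closed_compact; last exact: closed_closure.
have cM : closed [set x : 'rV[R]_n | `|x| <= M].
  exact: (@preimage_closed _ _ (fun x : 'rV[R]_n => `|x|) _
    (fun x _ => @norm_continuous _ _ x) (@closed_le R M)).
have OM : closure Om `<=` [set x | `|x| <= M].
  by rewrite closureE => x; apply; split.
exists M; split; first exact: num_real.
by move=> N MN x /OM /= xM; exact: le_trans xM (ltW MN).
Qed.

Lemma lebesgue_bounded_lty Om : measurable (Om : set (borel 'rV[R]_n)) ->
  bounded_set Om -> (lebesgue_rV n Om < +oo)%E.
Proof.
move=> mO bO; have [M M0 MO] := bounded_set_norm bO.
pose B : set (borel 'rV[R]_n) :=
  [set v | forall j, (const_mx (- (M + 1)) : 'rV[R]_n) 0 j <= v 0 j <=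
                     (const_mx (M + 1) : 'rV[R]_n) 0 j].
have mB : measurable B.
  rewrite -[B]setCK; apply: measurableC.
  apply: sub_sigma_algebra; rewrite openC.
  have -> : B = \bigcap_(j in [set: 'I_n])
      ((fun v : 'rV[R]_n => v 0 j) @^-1` `[- (M + 1), M + 1]%classic).
    apply/seteqP; split=> v /= Bv j; first by move=> _; have := Bv j; rewrite !mxE /= in_itv.
    by have := Bv j I; rewrite /= in_itv !mxE.
  apply: closed_bigI => j _.
  exact: (@preimage_closed _ _ (fun v : 'rV[R]_n => v 0 j) _
    (fun v _ => @coord_continuous R 1 n 0 j v)
    (@itv_closed _ R (- (M + 1)) (M + 1))).
(* the box has half-width M + 1, since membership in a ball is strict *)
have OB : Om `<=` B.
  move=> v Ov j; rewrite !mxE -ler_norml.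
  have : ball (0 : 'rV[R]_n) (M + 1) v.
    by rewrite -ball_normE /= sub0r normrN (le_lt_trans (MO v Ov))// ltrDl.
  case=> _ /(_ 0 j); rewrite mxE /ball /= sub0r normrN; exact: ltW.
apply: le_lt_trans (_ : lebesgue_rV n B < +oo)%E; first by apply: le_measure; rewrite ?inE.
rewrite lebesgue_rV_box ?ltry// => j; rewrite !mxE.
by rewrite -subr_ge0 opprK ltW// !addr_gt0.
Qed.

End domain.

Section growth.
Context {R : realType}.

Lemma continuous_enorm a b : continuous (@enorm R a b).
Proof.
have cS : continuous (fun s : 'M[R]_(a, b) => \sum_(i < a) \sum_(j < b) s i j ^+ 2).
  apply: continuous_big => [|i _]; first exact: add_continuous.
  apply: continuous_big => [|j _ s]; first exact: add_continuous.
  by apply: (@continuousM R); exact: coord_continuous.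
move=> s; apply: continuous_comp; first exact: cS.
exact: sqrt_continuous.
Qed.

Lemma enorm_ge0 a b (s : 'M[R]_(a, b)) : 0 <= enorm s.
Proof. exact: sqrtr_ge0. Qed.

Variables (n : nat) (Om : set 'rV[R]_n).
Let Om' : set (borel 'rV[R]_n) := Om.
Hypotheses (mOm : measurable Om') (Omy : (lebesgue_rV n Om' < +oo)%E).
Variables (a b : nat) (p : R).
Hypothesis p1 : 1 <= p.

Let p0 : 0 < p. Proof. exact: lt_le_trans p1. Qed.

Lemma in_Lp_measurable_enorm q (w : 'rV[R]_n -> 'M[R]_(a, b)) :
  in_Lp Om q w ->
  measurable_fun Om' (fun x : borel 'rV[R]_n => enorm (w x)).
Proof.
move=> [mw _]; apply: (@measurableT_comp _ _ _ _ (borel 'M[R]_(a, b)) _ (@enorm R a b)).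
  by apply: continuous_borel_fun; exact: continuous_enorm.
exact: mw.
Qed.

Lemma Lp_norm_powR (w : 'rV[R]_n -> 'M[R]_(a, b)) :
  (Lp_norm Om p%:E w `^ p =
   \int[lebesgue_rV n]_(x in Om') (enorm (w x) `^ p)%:E)%E.
Proof.
rewrite /Lp_norm powR_Lnorm ?gt_eqF// [RHS]integral_mkcond.
apply: eq_integral => x _; rewrite !patchE; case: ifPn => _ /=.
  by rewrite ger0_norm ?enorm_ge0.
by rewrite normr0 powR0// gt_eqF.
Qed.

Lemma integrable_growth (w : 'rV[R]_n -> 'M[R]_(a, b)) :
  in_Lp Om p%:E w ->
  (lebesgue_rV n).-integrable Om' (EFin \o (fun x => 1 + enorm (w x) `^ p)).
Proof.
move=> wLp.
have mp : measurable_fun Om' (fun x => enorm (w x) `^ p).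
  exact: measurableT_comp (@measurable_powR R p) (in_Lp_measurable_enorm wLp).
have i1 : (lebesgue_rV n).-integrable Om' (EFin \o cst 1).
  apply: (measurable_bounded_integrable mOm Omy) => //.
  exists 1; split; first exact: num_real.
  by move=> N N1 x _ /=; rewrite normr1 ltW.
have i2 : (lebesgue_rV n).-integrable Om' (EFin \o (fun x => enorm (w x) `^ p)).
  apply/integrableP; split; first exact/measurable_EFinP.
  under eq_integral do rewrite /= ger0_norm ?powR_ge0//.
  by rewrite -Lp_norm_powR poweR_lty//; case: wLp.
exact: (integrableD mOm i1 i2).
Qed.

Lemma Rintegral_growth_le (w : 'rV[R]_n -> 'M[R]_(a, b)) (C : R) :
  in_Lp Om p%:E w -> (Lp_norm Om p%:E w <= C%:E)%E ->
  \int[lebesgue_rV n]_(x in Om') (1 + enorm (w x) `^ p) <=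
    fine (lebesgue_rV n Om') + C `^ p.
Proof.
move=> wLp wC; rewrite -lee_fin EFin_Rintegral//; last exact: integrable_growth.
have mp : measurable_fun Om' (fun x => enorm (w x) `^ p).
  exact: measurableT_comp (@measurable_powR R p) (in_Lp_measurable_enorm wLp).
under eq_integral do rewrite EFinD.
rewrite ge0_integralD//; last 2 first.
- by move=> x _; rewrite lee_fin powR_ge0.
- exact/measurable_EFinP.
rewrite integral_cst// mul1e -Lp_norm_powR EFinD fineK ?ge0_fin_numE//.
have L0 : (0 <= Lp_norm Om p%:E w)%E by rewrite /Lp_norm Lnorm_ge0.
rewrite leeD2l// -poweR_EFin.
by apply: gt0_ler_poweR => //; rewrite ?ltW// in_itv /= ?leey ?andbT// (le_trans L0 wC).
Qed.

End growth.

(** * Extensions to a compactification *)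

Section compactification.
Context {R : realType} (E K : ptopologicalType) (A : set (E -> R)) (i : E -> K).
Hypothesis AK : compactification_of A i.

Lemma compactification_continuous : continuous i.
Proof.
have [_ _ [_ oi] _ _] := AK; apply/continuousP => W oW.
by apply/oi; exists W.
Qed.

Lemma extensionP f : A f -> continuous (extension i f) /\ extension i f \o i = f.
Proof.
have [_ _ _ _ Aext] := AK; move=> /Aext[F cF Ff].
by apply: (@getPex _ [set F : K -> R | continuous F /\ F \o i = f]); exists F.
Qed.

(** The set where the extension differs from [c] is open and misses the dense
image of [i]. *)
Lemma extension_cst (c : R) : A (cst c) -> extension i (cst c) = cst c.
Proof.
move=> /extensionP[cF Fi]; apply/funext => y; apply: contrapT => Fy.
have [_ _ _ di _] := AK.
have oN : open (extension i (cst c) @^-1` [set~ c]).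
  move: cF => /continuousP; apply; rewrite openC.
  exact: (accessible_closed_set1 (hausdorff_accessible (@Rhausdorff R))).
have [|z [Fz [x _ xz]]] := di _ _ oN; first by exists y.
by apply: Fz; rewrite -xz; exact: (congr1 (fun f => f x) Fi).
Qed.

End compactification.

(** * The limit of the joint laws and its iterated disintegration *)

Lemma within_continuous_measurable {R : realType} (E : ptopologicalType)
    (S : set E) (g : E -> R) : closed S -> {within S, continuous g} ->
  measurable_fun (S : set (borel E)) g.
Proof.
move=> cS /continuousP cg; apply: (@measurability _ _ (borel E)
  (measurableTypeR R) _ _ (@RGenOpens.G R)); first exact: RGenOpens.measurableE.
move=> _ [_ [a [b ->]] <-].
have oab : open (`]a, b[%classic : set R) by exact: interval_open.
have /open_subspaceP[W oW WS] := cg _ oab.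
rewrite setIC -WS; apply: measurableI; first exact: sub_sigma_algebra.
rewrite -[S]setCK; apply: measurableC.
by apply: sub_sigma_algebra; rewrite openC.
Qed.

Lemma measurable_fun_pair_on d d1 d2 (T : measurableType d)
    (T1 : measurableType d1) (T2 : measurableType d2) (D : set T)
    (f : T -> T1) (g : T -> T2) :
  measurable D -> measurable_fun D f -> measurable_fun D g ->
  measurable_fun D (fun t => (f t, g t)).
Proof.
move=> mD mf mg; apply/(measurable_restrictT _ mD).
have -> : (fun t => (f t, g t)) \_ D = (fun t => ((f \_ D) t, (g \_ D) t)).
  by apply/funext => t; rewrite !patchE; case: ifP.
by apply: measurable_fun_pair; exact/(measurable_restrictT _ mD).
Qed.

(* a product of pointed topological spaces as a pointed topological space *)
HB.saturate prod.

(** [weak_limit] for the maps [x |-> (x, y k x, r k x)].  The limit law is regarded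
as a measure on the whole product, carried by closure Om, and [g], which is
continuous on closure Om only, is extended by 0. *)
Lemma joint_limit {R : realType} (n : nat) (Om : set 'rV[R]_n)
    (L1 L2 : ptopologicalType) (y : nat -> 'rV[R]_n -> L1)
    (r : nat -> 'rV[R]_n -> L2) (rho : nat -> 'rV[R]_n -> R) (M : R) :
  let Om' := Om : set (borel 'rV[R]_n) in
  compact (closure Om) -> measurable Om' ->
  compact [set: L1] -> @metrizable R L1 ->
  compact [set: L2] -> @metrizable R L2 ->
  (forall k, measurable_fun Om' (y k : borel 'rV[R]_n -> borel L1)) ->
  (forall k, measurable_fun Om' (r k : borel 'rV[R]_n -> borel L2)) ->
  (forall k x, 0 <= rho k x) ->
  (forall k, (lebesgue_rV n).-integrable Om' (EFin \o rho k)) ->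
  (forall k, \int[lebesgue_rV n]_(x in Om') rho k x <= M) ->
  exists phi (Lam : {finite_measure
    set (borel 'rV[R]_n * borel L1 * borel L2)%type -> \bar R}),
  [/\ increasing_seq phi,
    Lam ((~` closure Om `*` [set: borel L1]) `*` [set: borel L2]) = 0%E &
    forall (g : 'rV[R]_n -> R) (G : L1 -> R) (F : L2 -> R),
      {within closure Om, continuous g} -> continuous G -> continuous F ->
      \int[lebesgue_rV n]_(x in Om')
        (g x * G (y (phi k) x) * F (r (phi k) x) * rho (phi k) x) @[k --> \oo] -->
      \int[Lam]_t ((g \_ (closure Om)) t.1.1 * G t.1.2 * F t.2)].
Proof.
move=> Om' cOm mOm cL1 mL1 cL2 mL2 my mr rho0 irho rhoM.
have [b0 [ob0 mb0]] := metrizable_mesh metrizable_rV cOm.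
have [b1 [ob1 mb1]] := metrizable_mesh mL1 cL1.
have [b2 [ob2 mb2]] := metrizable_mesh mL2 cL2.
pose S : set ('rV[R]_n * L1 * L2)%type := closure Om `*` [set: L1] `*` [set: L2].
have cS : compact S by apply: compact_setX => //; exact: compact_setX.
have mS := mesh_prod (mesh_prod mb0 mb1) mb2.
set b := (X in mesh _ X) in mS.
pose z k x := (x, y k x, r k x).
have zS k x : Om' x -> S (z k x).
  by move=> Ox; split=> //; split=> //; exact: subset_closure.
have mpre (L : ptopologicalType) (f : borel 'rV[R]_n -> borel L) (V : set L) :
    measurable_fun Om' f -> open V -> measurable (Om' `&` f @^-1` V).
  by move=> mf oV; apply: mf => //; exact: sub_sigma_algebra.
have mz k j : measurable (Om' `&` z k @^-1` b j).
  rewrite /b; case: (odd j); first exact: (mpre _ _ _ (mr k) (ob2 _)).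
  case: (odd j./2); first exact: (mpre _ _ _ (my k) (ob1 _)).
  by apply: measurableI => //; apply: sub_sigma_algebra; exact: ob0.
have [phi [m [chi [iphi chiS chiF]]]] := @weak_limit R _ S b _ _
  (lebesgue_rV n) Om' z rho M cS mS mOm zS mz (fun k x _ => rho0 k x) irho rhoM.
pose D : set (measurableTypeR R) := `[0, m[%classic.
have mD : measurable D by exact: measurable_itv.
have Dy : (lebesgue_measure D < +oo)%E.
  by rewrite (lebesgue_measure_itv `[0, m[) /=; case: ifP; rewrite // -EFinB ltry.
have DP t : D t -> 0 <= t < m by rewrite /D /= in_itv.
have cfst : continuous (fun e : ('rV[R]_n * L1 * L2)%type => e.1.1).
  by move=> e; apply: (@continuous_comp _ _ _ fst fst); exact: cvg_fst.
have csnd : continuous (fun e : ('rV[R]_n * L1 * L2)%type => e.1.2).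
  by move=> e; apply: (@continuous_comp _ _ _ fst snd); [exact: cvg_fst|exact: cvg_snd].
have cthd : continuous (fun e : ('rV[R]_n * L1 * L2)%type => e.2).
  by move=> e; exact: cvg_snd.
have mcomp (L : ptopologicalType) (f : ('rV[R]_n * L1 * L2)%type -> L) :
    @metrizable R L -> continuous f -> measurable_fun D (f \o chi : _ -> borel L).
  move=> mL cf; apply: (@measurable_fun_borel R) => // F cF.
  have [] := chiF (F \o f); last by [].
  by apply: continuous_subspaceT => e; apply: continuous_comp; [exact: cf|exact: cF].
(* the product carries the product of the Borel sigma-algebras: measurability is
   checked on each component *)
have mchi : measurable_fun D (chi : _ -> (borel 'rV[R]_n * borel L1 * borel L2)%type).
  rewrite (_ : chi = fun t => ((chi t).1.1, (chi t).1.2, (chi t).2)); last first.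
    by apply/funext => t; case: (chi t) => -[].
  apply: measurable_fun_pair_on => //; last exact: (mcomp _ _ mL2 cthd).
  apply: measurable_fun_pair_on => //; first exact: (mcomp _ _ metrizable_rV cfst).
  exact: (mcomp _ _ mL1 csnd).
have [Lam [LamE LamI]] := restricted_law mD Dy mchi.
have mcl : measurable (closure Om : set (borel 'rV[R]_n)).
  rewrite -[X in measurable X]setCK; apply: measurableC.
  by apply: sub_sigma_algebra; rewrite openC; exact: closed_closure.
exists phi, Lam; split=> //.
  rewrite LamE; last by apply: measurableX => //; apply: measurableX => //; exact: measurableC.
  rewrite (_ : _ `&` _ = set0) ?measure0//; apply/seteqP; split=> // t [Dt] /= [[nS _] _].
  by have [[]] := chiS t (DP t Dt).
move=> g G F cg cG cF.
pose H e := g e.1.1 * G e.1.2 * F e.2 : R.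
have cH : {within S, continuous (H : ('rV[R]_n * L1 * L2)%type -> R)}.
  apply/subspace_continuousP => e Se.
  have c1 : g e'.1.1 @[e' --> within S (nbhs e)] --> g e.1.1.
    apply: (@cvg_comp _ _ _ (fun e' : ('rV[R]_n * L1 * L2)%type => e'.1.1) g _
      (within (closure Om) (nbhs e.1.1))).
      move=> W /cfst; rewrite /= /within /= => eW.
      apply: (@filterS _ (nbhs e) (nbhs_filter e) _ _ _ eW).
      by move=> e' /= h [[clx _] _]; exact: h.
    by move/subspace_continuousP : cg; apply; case: Se => [[]].
  have cG' : continuous (fun e : ('rV[R]_n * L1 * L2)%type => G e.1.2).
    by move=> f; apply: continuous_comp; [exact: csnd|exact: cG].
  have cF' : continuous (fun e : ('rV[R]_n * L1 * L2)%type => F e.2).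
    by move=> f; apply: continuous_comp; [exact: cthd|exact: cF].
  have /subspace_continuousP/(_ e Se) c2 := continuous_subspaceT (A := S) cG'.
  have /subspace_continuousP/(_ e Se) c3 := continuous_subspaceT (A := S) cF'.
  exact: cvgM (cvgM c1 c2) c3.
have [_ hH] := chiF H cH.
have [Mg MgP] := bounded_within cOm cg.
have [MG MGP] := bounded_within cL1 (continuous_subspaceT cG).
have [MF MFP] := bounded_within cL2 (continuous_subspaceT cF).
pose h (t : (borel 'rV[R]_n * borel L1 * borel L2)%type) : R :=
  (g \_ (closure Om)) t.1.1 * G t.1.2 * F t.2.
have mh : measurable_fun setT h.
  apply: measurable_funM; last first.
    by apply: (@measurableT_comp _ _ _ _ (borel L2) _ F) => //; exact: continuous_borel_fun.
  apply: measurable_funM.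
    apply: (@measurableT_comp _ _ _ _ (borel 'rV[R]_n) _ (g \_ (closure Om))
      _ (fun t => t.1.1)).
      apply: (measurable_restrictT _ mcl).1.
      by apply: within_continuous_measurable cg; exact: closed_closure.
    exact: measurableT_comp measurable_fst measurable_fst.
  apply: (@measurableT_comp _ _ _ _ (borel L1) _ G _ (fun t => t.1.2)).
    exact: continuous_borel_fun.
  exact: measurableT_comp measurable_snd measurable_fst.
have hM t : `|h t| <= `|Mg| * `|MG| * `|MF|.
  rewrite /h !normrM; apply: ler_pM; rewrite ?mulr_ge0//.
    apply: ler_pM => //; last by apply: le_trans (ler_norm _); exact: MGP.
    rewrite patchE; case: ifPn => [/set_mem ct|_]; last by rewrite normr0.
    by apply: le_trans (ler_norm _); exact: MgP.
  by apply: le_trans (ler_norm _); exact: MFP.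
rewrite (LamI h (`|Mg| * `|MG| * `|MF|) mh hM).
rewrite (@eq_Rintegral _ _ _ _ _ (fun t => H (chi t))); first exact: hH.
move=> t /set_mem Dt; rewrite /h /H patchE mem_set//.
by have [[]] := chiS t (DP t Dt).
Qed.

(** [tau], the marginal on [X * L1], is disintegrated over its marginal [sigma],
and [Lam] over [tau].  Integrating out the last variable leaves a function of
[(x, s)] that depends on [s] only measurably, through [mu (x, s)]: this is why
continuous functions would not do in [disintegration]. *)
Lemma iterated_disintegration {R : realType} d (X : measurableType d)
    (L1 L2 : ptopologicalType)
    (Lam : {finite_measure set (X * borel L1 * borel L2)%type -> \bar R}) :
  compact [set: L1] -> @metrizable R L1 ->
  compact [set: L2] -> @metrizable R L2 ->
  exists (sigma : {finite_measure set X -> \bar R})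
    (nu : X -> probability (borel L1) R)
    (mu : X -> L1 -> probability (borel L2) R),
  [/\ forall A, measurable A ->
        sigma A = Lam ((A `*` [set: borel L1]) `*` [set: borel L2]),
    forall G : L1 -> R, continuous G ->
      measurable_fun setT (fun x => \int[nu x]_s G s),
    forall F : L2 -> R, continuous F ->
      measurable_fun setT
        (fun xs : (X * borel L1)%type => \int[mu xs.1 xs.2]_r F r) &
    forall (g : X -> R) (G : L1 -> R) (F : L2 -> R) (M : R),
      measurable_fun setT g -> (forall x, `|g x| <= M) ->
      continuous G -> continuous F ->
      \int[Lam]_t (g t.1.1 * G t.1.2 * F t.2) =
      \int[sigma]_x \int[nu x]_s \int[mu x s]_r (g x * F r * G s)].
Proof.
move=> cL1 mL1 cL2 mL2.
have [tau [tauE _]] := restricted_law measurableT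
  (fin_num_fun_lty (fin_num_measure Lam))
  (@measurable_fst _ _ (X * borel L1)%type (borel L2)).
have [sigma [sigmaE _]] := restricted_law measurableT
  (fin_num_fun_lty (fin_num_measure tau))
  (@measurable_fst _ _ X (borel L1)).
have tauE' A : measurable A -> tau A = Lam (A `*` [set: borel L2]).
  move=> mA; rewrite tauE// setTI; congr (Lam _).
  by apply/seteqP; split=> t /=; [split|case].
have sigmaE' A : measurable A -> sigma A = tau (A `*` [set: borel L1]).
  move=> mA; rewrite sigmaE// setTI; congr (tau _).
  by apply/seteqP; split=> t /=; [split|case].
have [mu [mmu muI]] := disintegration cL2 mL2 tauE'.
have [nu [mnu nuI]] := disintegration cL1 mL1 sigmaE'.
exists sigma, nu, (fun x s => mu (x, s)); split.
- by move=> A mA; rewrite sigmaE'// tauE'//; exact: measurable_cylinder.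
- exact: mnu.
- move=> F cF; have := mmu F cF; congr (measurable_fun _ _).
  by apply/funext => -[].
move=> g G F M mg gM cG cF.
have [MG MGP] := bounded_within cL1 (continuous_subspaceT cG).
have [MF MFP] := bounded_within cL2 (continuous_subspaceT cF).
have mG := continuous_borel_fun cG.
have mF := continuous_borel_fun cF.
have bnd x s r : `|g x * G s * F r| <= `|M| * `|MG| * `|MF|.
  rewrite !normrM; apply: ler_pM; rewrite ?mulr_ge0//.
    apply: ler_pM => //; apply: le_trans (ler_norm _); first exact: gM.
    exact: MGP.
  by apply: le_trans (ler_norm _); exact: MFP.
pose h1 (t : (X * borel L1 * borel L2)%type) : R := g t.1.1 * G t.1.2 * F t.2.
have mgG : measurable_fun setT (fun xs : (X * borel L1)%type => g xs.1 * G xs.2).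
  apply: measurable_funM.
    by apply: (@measurableT_comp _ _ _ _ _ _ g).
  by apply: (@measurableT_comp _ _ _ _ (borel L1) _ G).
have mh1 : measurable_fun setT h1.
  apply: measurable_funM.
    exact: (@measurableT_comp _ _ _ _ _ _ _ _ fst mgG measurable_fst).
  by apply: (@measurableT_comp _ _ _ _ (borel L2) _ F).
rewrite (muI h1 (`|M| * `|MG| * `|MF|) mh1); last by move=> t; exact: bnd.
pose h2 (xs : (X * borel L1)%type) : R := \int[mu xs]_r h1 (xs, r).
have h2E xs : h2 xs = g xs.1 * G xs.2 * \int[mu xs]_r F r.
  rewrite /h2 /h1 /= RintegralZl//.
  by apply: (@integrable_bounded _ _ _ _ _ _ MF) => // r _; exact: MFP.
have mh2 : measurable_fun setT h2.
  rewrite (_ : h2 = (fun xs => g xs.1 * G xs.2 * \int[mu xs]_r F r)).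
    by apply: measurable_funM => //; exact: mmu.
  by apply/funext => xs; exact: h2E.
rewrite (nuI h2 (`|M| * `|MG| * `|MF|) mh2); last first.
  move=> xs; apply: norm_Rintegral_probability => [|r]; last exact: bnd.
  exact: measurableT_comp mh1 (pair1_measurable xs).
apply: eq_Rintegral => x _; apply: eq_Rintegral => s _.
by apply: eq_Rintegral => r _; rewrite /h1 /= mulrAC.
Qed.

Lemma continuous_borel_map (E K : ptopologicalType) (i : E -> K) :
  continuous i -> measurable_fun setT (i : borel E -> borel K).
Proof.
move=> /continuousP ci.
apply: (@measurability _ _ (borel E) (borel K) _ _ (open : set (set K))) => //.
by move=> _ [W oW <-]; rewrite setTI; apply: sub_sigma_algebra; exact: ci.
Qed.

Theorem theorem4 (R : realType) (m n : nat) (Om : set 'rV[R]_n)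
    (U : set ('rV[R]_m -> R)) (KU : ptopologicalType) (iU : 'rV[R]_m -> KU)
    (V : set ('M[R]_(m, n) -> R)) (KV : ptopologicalType)
    (iV : 'M[R]_(m, n) -> KV)
    (q : \bar R) (p : R)
    (u : nat -> 'rV[R]_n -> 'rV[R]_m) (w : nat -> 'rV[R]_n -> 'M[R]_(m, n)) :
  (0 < m)%N -> (0 < n)%N ->
  bounded_lipschitz_domain Om ->
  complete_ring U -> sup_separable U -> compactification_of U iU ->
  complete_ring V -> sup_separable V -> compactification_of V iV ->
  (1 <= q)%E -> 1 <= p ->
  bounded_in_Lp Om q u -> bounded_in_Lp Om p%:E w ->
  exists (phi : nat -> nat)
    (sigma : {finite_measure set (borel 'rV[R]_n) -> \bar R})
    (nu : 'rV[R]_n -> probability (borel KV) R)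
    (mu : 'rV[R]_n -> KV -> probability (borel KU) R),
  [/\ increasing_seq phi,
      DiPerna_Majda Om p V iV (sigma, nu),
      parametrized_young_measure Om sigma nu mu,
      forall (f0 : 'rV[R]_m -> R) (psi0 : 'M[R]_(m, n) -> R)
             (g : 'rV[R]_n -> R),
        U f0 -> V psi0 -> {within closure Om, continuous g} ->
        \int[lebesgue_rV n]_(x in Om)
          (g x * f0 (u (phi k) x) * growth p psi0 (w (phi k) x)) @[k --> \oo]
        --> \int[sigma]_(x in closure Om) \int[nu x]_s \int[mu x s]_r
              (g x * extension iU f0 r * extension iV psi0 s) &
      generates Om p V iV (w \o phi) sigma nu].
Proof.
move=> _ _ [_ oOm _ bOm _] [_ [Ucst _ _] _ _] _ cU _ _ cV _ p1 [uLp _] [wLp [C wC]].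
have [cKU mKU _ _ _] := cU; have [cKV mKV _ _ _] := cV.
pose Om' : set (borel 'rV[R]_n) := Om.
have mOm : measurable Om' by exact: sub_sigma_algebra.
have Omy := lebesgue_bounded_lty mOm bOm.
have cOm := compact_closure_bounded bOm.
have miV := continuous_borel_map (compactification_continuous cV).
have miU := continuous_borel_map (compactification_continuous cU).
have my k : measurable_fun Om' (iV \o w k : borel _ -> borel KV).
  exact: measurableT_comp miV (wLp k).1.
have mr k : measurable_fun Om' (iU \o u k : borel _ -> borel KU).
  exact: measurableT_comp miU (uLp k).1.
pose rho k x := 1 + enorm (w k x) `^ p.
have rho0 k x : 0 <= rho k x by rewrite addr_ge0// powR_ge0.
have [phi [Lam [iphi Lam0 LamP]]] := joint_limit cOm mOm cKV mKV cKU mKU my mr rho0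
  (fun k => integrable_growth mOm Omy p1 (wLp k))
  (fun k => Rintegral_growth_le mOm Omy p1 (wLp k) (wC k)).
have [sigma [nu [mu [sigmaE mnu mmu LamI]]]] :=
  iterated_disintegration Lam cKV mKV cKU mKU.
have mcl : measurable (closure Om : set (borel 'rV[R]_n)).
  rewrite -[X in measurable X]setCK; apply: measurableC.
  by apply: sub_sigma_algebra; rewrite openC; exact: closed_closure.
have cvg_eq (f h : nat -> R) (l l' : R) : (forall k, f k = h k) -> l = l' ->
    f k @[k --> \oo] --> l -> h k @[k --> \oo] --> l'.
  by move=> /funext -> ->.
have main (f0 : 'rV[R]_m -> R) (psi0 : 'M[R]_(m, n) -> R) (g : 'rV[R]_n -> R) :
    U f0 -> V psi0 -> {within closure Om, continuous g} ->
    \int[lebesgue_rV n]_(x in Om)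
      (g x * f0 (u (phi k) x) * growth p psi0 (w (phi k) x)) @[k --> \oo]
    --> \int[sigma]_(x in closure Om) \int[nu x]_s \int[mu x s]_r
          (g x * extension iU f0 r * extension iV psi0 s).
  move=> Uf Vpsi cg; have [cF Fi] := extensionP cU Uf.
  have [cG Gi] := extensionP cV Vpsi.
  have [M MP] := bounded_within cOm cg.
  apply: (cvg_eq _ _ _ _ _ _ (LamP g _ _ cg cG cF)) => [k|].
    apply: eq_Rintegral => x _.
    have -> : extension iV psi0 (iV (w (phi k) x)) = psi0 (w (phi k) x).
      exact: (congr1 (fun h => h (w (phi k) x)) Gi).
    have -> : extension iU f0 (iU (u (phi k) x)) = f0 (u (phi k) x).
      exact: (congr1 (fun h => h (u (phi k) x)) Fi).
    by rewrite /growth /rho mulrA (mulrAC (g x)).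
  apply: etrans (LamI (g \_ (closure Om)) _ _ `|M| _ _ cG cF) _.
  - apply: (measurable_restrictT _ mcl).1.
    by apply: within_continuous_measurable cg; exact: closed_closure.
  - move=> x; rewrite patchE; case: ifPn => [/set_mem xcl|_]; last by rewrite normr0.
    by apply: le_trans (ler_norm _); exact: MP.
  (* outside closure Om, both sides vanish because [g] is extended by 0 there *)
  rewrite [RHS]Rintegral_mkcond; apply: eq_Rintegral => x _; rewrite !patchE.
  case: ifPn => xcl //.
  rewrite -[RHS](mul0r (fine (nu x setT))) -Rintegral_cst//.
  apply: eq_Rintegral => s _; rewrite -[RHS](mul0r (fine (mu x s setT))).
  by rewrite -Rintegral_cst//; apply: eq_Rintegral => r _; rewrite !mul0r.
have gen : generates Om p V iV (w \o phi) sigma nu.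
  move=> g psi0 cg Vpsi.
  apply: (cvg_eq _ _ _ _ _ _ (main (cst 1) psi0 g (Ucst 1) Vpsi cg)) => [k|].
    by apply: eq_Rintegral => x _; rewrite mulr1.
  rewrite (extension_cst cU (Ucst 1)).
  apply: eq_Rintegral => x _; have [cG _] := extensionP cV Vpsi.
  have [M MP] := bounded_within cKV (continuous_subspaceT cG).
  rewrite -RintegralZl//; last first.
    apply: (@integrable_bounded _ _ _ _ _ _ M) => [//||s _]; last exact: MP.
    exact: continuous_borel_fun.
  apply: eq_Rintegral => s _.
  rewrite /= Rintegral_cst// [X in fine X]probability_setT.
  by rewrite !mulr1.
(* the integrals against [nu] and [mu] are measurable everywhere, so that the
   exceptional null sets are empty *)
exists phi, sigma, nu, mu; split=> //.
- split; last by exists (w \o phi) => // k; exact: wLp.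
  + by rewrite sigmaE//; exact: measurableC.
  + move=> F cF; exists (fun x => \int[nu x]_s F s).
      by apply: measurable_funTS; exact: mnu.
    exact: aeW.
- move=> F cF; exists (fun xs => \int[mu xs.1 xs.2]_r F r).
    by apply: measurable_funTS; exact: mmu.
  exists set0; split=> //; last by move=> xs /= [].
  rewrite /disintegrated_measure integral0_eq// => x _.
  by rewrite xsection0 measure0.
Qed.
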